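(* Let $X_1,\ldots,X_n$ be independent random variables, let $T=T(X_1,\ldots,X_n)$ be a statistic, and write $T=W+\Delta$ with $$W=\sum_{i=1}^n g_i(X_i),\qquad \Delta=\Delta(X_1,\ldots,X_n)=T-W,$$ where the $g_i$ are Borel measurable functions with $\mathrm{E}(g_i(X_i))=0$ for $i=1,\ldots,n$ and $\sum_{i=1}^n \mathrm{E}(g_i^2(X_i))=1$. For each $1\le i\le n$, let $\Delta_i$ be a random variable such that $X_i$ and $(\Delta_i,\,W-g_i(X_i))$ are independent. Then for every $\delta>0$ satisfying $$\sum_{i=1}^n \mathrm{E}|g_i(X_i)|\min(\delta,|g_i(X_i)|)\ge 1/2,$$ we have $$\sup_z|P(T\le z)-P(W\le z)|\le 4\delta+\mathrm{E}|W\Delta|+\sum_{i=1}^n \mathrm{E}|g_i(X_i)(\Delta-\Delta_i)|.$$ In particular, $$\sup_z|P(T\le z)-P(W\le z)|\le 2\beta+\mathrm{E}|W\Delta|+\sum_{i=1}^n \mathrm{E}|g_i(X_i)(\Delta-\Delta_i)|$$ and $$\sup_z|P(T\le z)-\Phi(z)|\le 6.1\,\beta+\mathrm{E}|W\Delta|+\sum_{i=1}^n \mathrm{E}|g_i(X_i)(\Delta-\Delta_i)|,$$ where $$\beta=\sum_{i=1}^n \mathrm{E}|g_i(X_i)|^2 I(|g_i(X_i)|>1)+\sum_{i=1}^n \mathrm{E}|g_i(X_i)|^3 I(|g_i(X_i)|\le 1).$$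
   Context: $\Phi$ is the standard normal distribution function, $I(\cdot)$ is the indicator function, and suprema are over $z\in\mathbb{R}$. The random variables $\Delta_i$ are defined on the same probability space as $X_1,\ldots,X_n$. The functions $g_i$ may depend on $n$. *)

(* Defs.v *)
From HB Require Import structures.
From mathcomp Require Import all_boot all_order all_algebra.
From mathcomp Require Import all_classical all_reals all_analysis.

Set Implicit Arguments.
Unset Strict Implicit.
Unset Printing Implicit Defensive.

Import Order.TTheory GRing.Theory Num.Theory.
Import numFieldNormedType.Exports.

Local Open Scope classical_set_scope.
Local Open Scope ring_scope.
Local Open Scope ereal_scope.

Definition mutually_independent d (Omega : measurableType d) (R : realType)
    (P : probability Omega R) (n : nat) (X : 'I_n -> {RV P >-> R}) : Prop :=
  forall (J : {set 'I_n}) (B : 'I_n -> set R),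
    (forall i, measurable (B i)) ->
    P (\bigcap_(i in [set` J]) (X i @^-1` B i))
      = \prod_(i in J) P (X i @^-1` B i).

(* The values lie in arbitrary measurable spaces, so that a random vector is
   covered by taking a product space for T1 or T2. *)
Definition independent2 d d1 d2 (Omega : measurableType d)
    (T1 : measurableType d1) (T2 : measurableType d2) (R : realType)
    (P : probability Omega R) (U : Omega -> T1) (V : Omega -> T2) : Prop :=
  forall (A : set T1) (B : set T2), measurable A -> measurable B ->
    P (U @^-1` A `&` V @^-1` B) = P (U @^-1` A) * P (V @^-1` B).

Definition Phi (R : realType) (z : R) : \bar R :=
  normal_prob 0%R 1%R `]-oo, z].

Definition sup_dist (R : realType) (F G : R -> \bar R) : \bar R :=
  ereal_sup [set `|F z - G z| | z in [set: R]].

(* Main.v *)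
(* Randomized concentration inequality (Chen and Shao).  For D >= 0 let f_D be
   the function of slope 1 on [z - delta, z + D + delta], constant outside, with
   |f_D| <= D/2 + delta.  Since X_i is independent of (Delta_i, W - xi_i),
   E[xi_i f_{Delta_i}(W - xi_i)] = 0, so E[W f_Delta(W)] dominates
   E[1(z <= W <= z + |Delta|) sum_i |xi_i| min(delta, |xi_i|)] up to half the
   remainder; the variance of the inner sum is at most delta^2.  This gives
   P(z <= W <= z + |Delta|) <= 3 delta + remainder.

   For the normal approximation, let f solve f'(w) - w f(w) = 1(w <= z) - c with
   c = Phi(z).  Then P(W <= z) - c = E f'(W) - E[W f(W)] is a sum over i of
   averages of f'(V + xi_i) - f'(V + t), where V = W - xi_i and t lies between 0
   and an independent copy of xi_i.  As w f(w) is nondecreasing of total variation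
   at most 1 and 1(w <= z) is nonincreasing, each such difference of expectations
   is at most the concentration function of V, which the first part bounds by
   l + 2.1 beta on intervals of length l.  Summing gives
   |P(W <= z) - Phi(z)| <= (2.1 + 2) beta. *)
From HB Require Import structures.
Require Import Defs.
From mathcomp Require Import all_boot all_order all_algebra.
From mathcomp Require Import all_classical all_reals all_analysis.
From mathcomp Require Import measurable_realfun ring lra.

Set Implicit Arguments.
Unset Strict Implicit.
Unset Printing Implicit Defensive.

Import Order.TTheory GRing.Theory Num.Theory.
Import numFieldNormedType.Exports.

Local Open Scope classical_set_scope.
Local Open Scope ring_scope.

(** * Real-valued expectations *)

(** Constants. In the first part 3 delta is 2 + 1: delta E|W| <= delta, and replacing the inner sum
    S by its mean s >= 1/2 costs only E(S - s)^- = E|S - s|/2 <= delta/2; dividing by 1/2 doubles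
    both. The choice delta = beta/2 is admissible for beta < 1/2; otherwise 2 beta >= 1 and the
    bound is trivial. The normal approximation needs concentration of V, which has lost one summand
    of S, and beta/2 leaves no slack for that loss. The choice delta = 7/10 beta does once beta <=
    10/41, whence 3 delta = 21/10 beta; for larger beta the bound exceeds 1. The last constant is 2
    + 41/10. Obstacles. Delta and Delta_i are not assumed to have moments and the remainder may be
    infinite, so concentration is first proved for truncations. The function f has a corner at z, so
    f' is never formed: two-sided bounds on increments of f, averaged over V, replace it. Its
    oscillation is also capped at 1, so that large |xi_i| enter through second moments only, as beta
    requires. *)

Lemma measurable_le_set d (T : measurableType d) (R : realType) (f g : T -> R) :
  measurable_fun setT f -> measurable_fun setT g -> measurable [set w | f w <= g w].
Proof. by move=> mf mg; rewrite -[X in measurable X]setTI; exact: measurable_fun_le. Qed.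

Lemma measurable_between d (T : measurableType d) (R : realType) (f g h : T -> R) :
  measurable_fun setT f -> measurable_fun setT g -> measurable_fun setT h ->
  measurable [set w | f w <= g w <= h w].
Proof.
move=> mf mg mh.
have -> : [set w | f w <= g w <= h w] = [set w | f w <= g w] `&` [set w | g w <= h w].
  by apply/seteqP; split => w /=; [move=> /andP[]|move=> [? ?]; apply/andP].
by apply: measurableI; exact: measurable_le_set.
Qed.

Section expectation.
Context {d} {T : measurableType d} {R : realType} (P : probability T R).
Implicit Types f g h : T -> R.

Definition integrableR f := P.-integrable [set: T] (EFin \o f).

(** Real-valued, so that [lra] and [nra] apply; an infinite integral is sent to 0, which is why most
    laws below ask for integrability. *)
Definition Ex f : R := (\int[P]_w f w)%R.

Lemma integrableR_measurable f : integrableR f -> measurable_fun setT f.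
Proof. by move=> /measurable_int/measurable_EFinP. Qed.

Lemma Ex_EFin f : integrableR f -> (\int[P]_w (f w)%:E = (Ex f)%:E)%E.
Proof. by move=> fi; rewrite /Ex /Rintegral fineK//; exact: integrable_fin_num. Qed.

Lemma integrableR_le g f : measurable_fun setT f -> integrableR g ->
  (forall w, `|f w| <= `|g w|) -> integrableR f.
Proof.
move=> mf gi fg; apply: le_integrable gi => //; first exact/measurable_EFinP.
by move=> w _; rewrite /= lee_fin.
Qed.

Lemma integrableR_cst c : integrableR (fun=> c).
Proof. exact: finite_measure_integrable_cst. Qed.

Lemma integrableR_bounded c f : measurable_fun setT f ->
  (forall w, `|f w| <= c) -> integrableR f.
Proof.
move=> mf fc; apply: (integrableR_le mf (integrableR_cst c)) => w.
exact: le_trans (fc w) (ler_norm c).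
Qed.

Lemma integrableRD f g : integrableR f -> integrableR g ->
  integrableR (fun w => f w + g w).
Proof. by move=> fi gi; exact: (@integrableD _ _ _ _ _ _ (EFin \o f) (EFin \o g)). Qed.

Lemma integrableRB f g : integrableR f -> integrableR g ->
  integrableR (fun w => f w - g w).
Proof. by move=> fi gi; exact: (@integrableB _ _ _ _ _ _ (EFin \o f) (EFin \o g)). Qed.

Lemma integrableRZ c f : integrableR f -> integrableR (fun w => c * f w).
Proof. by move=> fi; exact: (@integrableZl _ _ _ P _ _ c (EFin \o f)). Qed.

Lemma integrableR_norm f : integrableR f -> integrableR (fun w => `|f w|).
Proof. exact: integrable_norm. Qed.

Lemma integrableR_sum I (s : seq I) (Q : pred I) (f : I -> T -> R) :
  (forall i, Q i -> integrableR (f i)) ->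
  integrableR (fun w => \sum_(i <- s | Q i) f i w).
Proof.
move=> fi; elim: s => [|i s ih].
  rewrite (_ : (fun w : T => \sum_(i <- [::] | Q i) f i w) = fun=> 0); first exact: integrableR_cst.
  by apply/funext => w; rewrite big_nil.
rewrite (_ : (fun w : T => \sum_(j <- i :: s | Q j) f j w) = fun w =>
    if Q i then f i w + \sum_(j <- s | Q j) f j w else \sum_(j <- s | Q j) f j w); last first.
  by apply/funext => w; rewrite big_cons.
by case: (boolP (Q i)) => [Qi|_]//; apply: integrableRD => //; exact: fi.
Qed.

Lemma Ex_cst c : Ex (fun=> c) = c.
Proof.
have := Rintegral_cst P (@measurableT _ T) c; rewrite -/(Ex _) => ->.
by have := @probability_setT _ _ _ P => /= ->; rewrite mulr1.
Qed.

Lemma ExD f g : integrableR f -> integrableR g ->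
  Ex (fun w => f w + g w) = Ex f + Ex g.
Proof. by move=> fi gi; exact: RintegralD. Qed.

Lemma ExB f g : integrableR f -> integrableR g ->
  Ex (fun w => f w - g w) = Ex f - Ex g.
Proof. by move=> fi gi; exact: RintegralB. Qed.

Lemma ExZ c f : integrableR f -> Ex (fun w => c * f w) = c * Ex f.
Proof. by move=> fi; exact: RintegralZl. Qed.

Lemma Ex_sum I (s : seq I) (Q : pred I) (f : I -> T -> R) :
  (forall i, Q i -> integrableR (f i)) ->
  Ex (fun w => \sum_(i <- s | Q i) f i w) = \sum_(i <- s | Q i) Ex (f i).
Proof.
move=> fi; elim: s => [|i s ih].
  rewrite (_ : (fun w : T => \sum_(i <- [::] | Q i) f i w) = fun=> 0) ?Ex_cst ?big_nil//.
  by apply/funext => w; rewrite big_nil.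
rewrite (_ : (fun w : T => \sum_(j <- i :: s | Q j) f j w) = fun w =>
    if Q i then f i w + \sum_(j <- s | Q j) f j w else \sum_(j <- s | Q j) f j w); last first.
  by apply/funext => w; rewrite big_cons.
rewrite big_cons; case: (boolP (Q i)) => [Qi|_]//.
by rewrite ExD ?ih//; [exact: fi|exact: integrableR_sum].
Qed.

Lemma Ex_le f g : integrableR f -> integrableR g -> (forall w, f w <= g w) ->
  Ex f <= Ex g.
Proof. by move=> fi gi fg; exact: le_Rintegral. Qed.

Lemma Ex_ge0 f : (forall w, 0 <= f w) -> 0 <= Ex f.
Proof. by move=> f0; exact: Rintegral_ge0. Qed.

Lemma Ex_le_norm f : integrableR f -> `|Ex f| <= Ex (fun w => `|f w|).
Proof. by move=> fi; exact: le_normr_Rintegral. Qed.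

Lemma integrableR_indic A : measurable A -> integrableR (\1_A).
Proof. by move=> mA; exact: integrable_indic. Qed.

Lemma Ex_indic A : measurable A -> (Ex \1_A)%:E = P A.
Proof.
move=> mA; rewrite -Ex_EFin; last exact: integrableR_indic.
by rewrite integral_indic// setIT.
Qed.

Lemma integrableR_sqr f : measurable_fun setT f ->
  integrableR (fun w => f w ^+ 2) -> integrableR f.
Proof.
move=> mf f2i.
apply: (integrableR_le mf (integrableRD (integrableR_cst 1) f2i)) => w.
rewrite (ger0_norm (_ : 0 <= 1 + f w ^+ 2)) ?addr_ge0 ?sqr_ge0//.
rewrite -[f w ^+ 2]real_normK ?num_real//; have := normr_ge0 (f w).
by move: `|f w| => x; nra.
Qed.

Lemma integrableRM f g : measurable_fun setT f -> measurable_fun setT g ->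
  integrableR (fun w => f w ^+ 2) -> integrableR (fun w => g w ^+ 2) ->
  integrableR (fun w => f w * g w).
Proof.
move=> mf mg f2 g2.
apply: (integrableR_le (measurable_funM mf mg) (integrableRD f2 g2)) => w.
rewrite [X in _ <= X]ger0_norm ?addr_ge0 ?sqr_ge0// normrM.
rewrite -[f w ^+ 2]real_normK ?num_real// -[g w ^+ 2]real_normK ?num_real//.
have := normr_ge0 (f w); have := normr_ge0 (g w).
by move: `|f w| `|g w| => x y; nra.
Qed.

Lemma integrableRM_bounded c f g : measurable_fun setT f -> measurable_fun setT g ->
  integrableR f -> (forall w, `|g w| <= c) ->
  integrableR (fun w => f w * g w).
Proof.
move=> mf mg fi gc.
apply: (integrableR_le (measurable_funM mf mg) (integrableRZ c fi)) => w.
rewrite !normrM mulrC ler_wpM2r//.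
exact: le_trans (gc w) (ler_norm c).
Qed.

End expectation.

(** * Fubini for independent pairs *)

Section independence.
Context {d d1 d2} {T : measurableType d} {T1 : measurableType d1}
  {T2 : measurableType d2} {R : realType} (P : probability T R).

Lemma independent2_comp d1' d2' (T1' : measurableType d1')
    (T2' : measurableType d2') (U : T -> T1) (V : T -> T2)
    (u : T1 -> T1') (v : T2 -> T2') :
  measurable_fun setT u -> measurable_fun setT v ->
  independent2 P U V -> independent2 P (u \o U) (v \o V).
Proof.
move=> mu mv UV A B mA mB; apply: (UV (u @^-1` A) (v @^-1` B)).
  by rewrite -[X in measurable X]setTI; exact: mu.
by rewrite -[X in measurable X]setTI; exact: mv.
Qed.

Variables (U : T -> T1) (V : T -> T2).
Hypotheses (mU : measurable_fun setT U) (mV : measurable_fun setT V).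

Let U_ : {mfun T >-> T1} := mfun_Sub (mem_set mU).
Let V_ : {mfun T >-> T2} := mfun_Sub (mem_set mV).
Let mUV : measurable_fun setT (fun w => (U w, V w)).
Proof. exact/measurable_fun_pair. Qed.
Let UV_ : {mfun T >-> (T1 * T2)%type} := mfun_Sub (mem_set mUV).

(** By independence the joint law of [(U, V)] is the product of the marginals, since both agree on
    rectangles; the rest is Fubini. Every section, and not just almost every one, is assumed
    integrable so that the real-valued inner [Ex] equals the extended inner integral at each
    point. *)
Lemma Ex_independent2 (h : T1 * T2 -> R) : independent2 P U V ->
  measurable_fun setT h ->
  integrableR P (fun w => h (U w, V w)) ->
  (forall w, integrableR P (fun w' => h (U w, V w'))) ->
  integrableR P (fun w => Ex P (fun w' => h (U w, V w'))) /\
  Ex P (fun w => h (U w, V w)) = Ex P (fun w => Ex P (fun w' => h (U w, V w'))).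
Proof.
move=> UV mh hi hi2.
pose m1 := distribution P U_; pose m2 := distribution P V_.
pose m := distribution P UV_.
have mE A : measurable A -> (m1 \x m2)%E A = m A.
  by apply: product_measure_unique => B C mB mC; exact: UV.
have hm : m.-integrable setT (EFin \o h).
  apply/integrableP; split; first exact/measurable_EFinP.
  rewrite ge0_integral_distribution//.
    by move/integrableP : hi => [].
  by do 2 apply: measurableT_comp => //.
have hm12 : (m1 \x m2)%E.-integrable setT (EFin \o h).
  apply/integrableP; split; first exact/measurable_EFinP.
  rewrite (@eq_measure_integral _ _ _ _ m)//; last by move=> A mA _; exact: mE.
  by move/integrableP : hm => [].
have FE w : fubini_F m2 (EFin \o h) (U w) = (Ex P (fun w' => h (U w, V w')))%:E.
  rewrite -Ex_EFin// /fubini_F integral_pushforward//.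
    apply/measurable_EFinP => //; apply: measurableT_comp => //.
  exact: hi2.
have /integrableP[mF Foo] := integrable_fubini_F hm12.
have Fi : P.-integrable setT (fubini_F m2 (EFin \o h) \o U).
  apply/integrableP; split; first exact: measurableT_comp.
  move: Foo; rewrite ge0_integral_distribution//.
  by apply: measurableT_comp => //.
split; first by apply: eq_integrable Fi => // w _; exact: FE.
rewrite /Ex /Rintegral; congr fine.
transitivity (\int[m]_z (EFin \o h) z)%E.
  rewrite integral_pushforward//; exact/measurable_EFinP.
transitivity (\int[(m1 \x m2)%E]_z (EFin \o h) z)%E.
  by apply: eq_measure_integral => A mA _; apply/esym; exact: mE.
rewrite -(integral12_prod_meas1 hm12) integral_pushforward//.
by apply: eq_integral => w _; exact: FE.
Qed.

End independence.

(** * Independence *)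

Lemma Ex_indepM d (T : measurableType d) (R : realType) (P : probability T R)
    (U V : T -> R) : independent2 P U V ->
  integrableR P U -> integrableR P V -> integrableR P (fun w => U w * V w) ->
  Ex P (fun w => U w * V w) = Ex P U * Ex P V.
Proof.
move=> UV Ui Vi UVi.
have [_ ->] := @Ex_independent2 _ _ _ _ _ _ _ P U V (integrableR_measurable Ui)
  (integrableR_measurable Vi) (fun z => z.1 * z.2) UV (measurable_funM
  measurable_fst measurable_snd) UVi (fun w => integrableRZ (U w) Vi).
rewrite mulrC -ExZ//; congr (Ex P _); apply/funext => w /=.
by rewrite ExZ// mulrC.
Qed.

(** Rectangles are a pi-system generating the product sigma-algebra, and the whole space is a
    rectangle of finite measure. Neither measure has to be a product here. *)
Lemma eq_measure_rectangles d1 d2 (T1 : measurableType d1)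
    (T2 : measurableType d2) (R : realType)
    (m m' : {measure set (T1 * T2) -> \bar R}) :
  (m setT < +oo)%E ->
  (forall A B, measurable A -> measurable B -> m (A `*` B) = m' (A `*` B)) ->
  forall X, measurable X -> m X = m' X.
Proof.
move=> moo mm' X mX.
pose C : set (set (T1 * T2)) :=
  [set C | exists A, measurable A /\ exists B, measurable B /\ C = A `*` B].
apply: (measure_unique C (fun=> setT)) => //.
- rewrite measurable_prod_measurableType //; congr (<<s _ >>).
  rewrite predeqE; split => [[A mA [B mB <-]]|[A [mA [B [mB ->]]]]].
    by exists A; split => //; exists B.
  by exists A => //; exists B.
- move=> /= _ _ [X1 [mX1 [X2 [mX2 ->]]]] [Y1 [mY1 [Y2 [mY2 ->]]]].
  rewrite -setXI; exists (X1 `&` Y1); split; first exact: measurableI.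
  by exists (X2 `&` Y2); split => //; exact: measurableI.
- by move=> _; exists setT; split => //; exists setT; split => //; rewrite setXTT.
- by rewrite bigcup_const//; exists 0%N.
- by move=> A [A1 [mA1 [A2 [mA2 ->]]]]; exact: mm'.
Qed.

Section mutual_independence.
Context {d} {T : measurableType d} {R : realType} (P : probability T R).
Variables (n : nat) (X : 'I_n -> {RV P >-> R}) (g : 'I_n -> R -> R).
Hypothesis mX : mutually_independent X.
Hypothesis mg : forall i, measurable_fun setT (g i).

Let S (s : seq 'I_n) w := \sum_(k <- s) g k (X k w).

Let mgX k : measurable_fun setT (fun w => g k (X k w)).
Proof. exact: measurableT_comp. Qed.

Let mS s : measurable_fun setT (S s).
Proof. exact: measurable_sum. Qed.

Let capX (J : {set 'I_n}) (B : 'I_n -> set R) :=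
  \bigcap_(i in [set` J]) (X i @^-1` B i).

Let measurable_capX J B : (forall i, measurable (B i)) -> measurable (capX J B).
Proof.
move=> mB; apply: fin_bigcap_measurable; first exact: finite_finset.
by move=> i _; rewrite -[X in measurable X]setTI; exact: measurable_funP.
Qed.

(* Each step moves one index from J into s: the measures
   P ((X k, S s) \in _ /\ capX J B) and P ((X k, S s) \in _) * P (capX J B) agree
   on rectangles. *)
Lemma mutually_independent_sum (s : seq 'I_n) (J : {set 'I_n}) A B :
  uniq s -> (forall k, k \in s -> k \notin J) ->
  measurable A -> (forall i, measurable (B i)) ->
  (P (S s @^-1` A `&` capX J B) = P (S s @^-1` A) * P (capX J B))%E.
Proof.
elim: s J A B => [|k s ih] J A B.
  move=> _ _ mA mB.
  have S0 w : S [::] w = 0 by rewrite /S big_nil.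
  have [A0|A0] := pselect (A 0).
    have -> : S [::] @^-1` A = setT.
      by apply/seteqP; split => // w _; rewrite /preimage/= S0.
    by rewrite setTI probability_setT mul1e.
  have -> : S [::] @^-1` A = set0.
    by apply/seteqP; split => // w; rewrite /preimage/= S0.
  by rewrite set0I measure0 mul0e.
move=> /= /andP[ks us] sJ mA mB.
have kJ : k \notin J by apply: sJ; rewrite mem_head.
pose E := capX J B.
have mE : measurable E by exact: measurable_capX.
have mXS : measurable_fun setT (fun w => (X k w, S s w)).
  exact/measurable_fun_pair.
pose XS : {mfun T >-> (R * R)%type} := mfun_Sub (mem_set mXS).
pose p := fine (P E).
have pE : P E = p%:E by rewrite /p fineK// fin_num_measure.
have p0 : 0 <= p by exact: fine_ge0.
pose m1 := pushforward (mrestr P mE) XS.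
pose m2 := mscale (NngNum p0) (distribution P XS).
have key : forall C, measurable C -> m1 C = m2 C.
  apply: eq_measure_rectangles => [|C1 C2 mC1 mC2].
    by change (P (XS @^-1` setT `&` E) < +oo)%E; rewrite preimage_setT setTI pE ltry.
  transitivity (m1 (C1 `*` C2)); first by [].
  transitivity (m2 (C1 `*` C2)); last by [].
  (* On a rectangle the event for [X k] becomes one more constraint of the intersection, now over
     [k |: J], so the induction hypothesis applies to [s]; with [[set k]] it also evaluates the
     other side. *)
  pose B' i := if i == k then C1 else B i.
  have mB' i : measurable (B' i) by rewrite /B'; case: eqP.
  have -> : m1 (C1 `*` C2) = P (S s @^-1` C2 `&` capX (k |: J) B').
    congr (P _); apply/seteqP; split => w /=.
      move=> [[/= w1 w2] wE]; split => // i /=.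
      rewrite in_setU1 /B' => /orP[/eqP ->|iJ]; first by rewrite eqxx.
      by case: eqP => [->//|_]; exact: wE.
    move=> [w2 wE]; split; last first.
      move=> i iJ; have /wE : [set` k |: J] i by rewrite /= in_setU1 [_ \in J]iJ orbT.
      by rewrite /B'; case: eqP => // ik; move: iJ; rewrite /= ik (negbTE kJ).
    split => //=; have /wE : [set` k |: J] k by rewrite /= in_setU1 eqxx.
    by rewrite /B' /= eqxx.
  rewrite ih//; last first.
    move=> i si; rewrite in_setU1 negb_or sJ ?andbT ?inE ?si ?orbT//.
    by apply: contraNneq ks => <-.
  rewrite /capX mX// big_setU1//= /B' eqxx.
  under eq_bigr => i iJ.
    rewrite (_ : (i == k) = false); last first.
      by apply/negbTE; apply: contraNneq kJ => <-.
    over.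
  rewrite -mX// -/(capX J B) -/E pE.
  rewrite /m2 /mscale /= /distribution /pushforward.
  have -> : XS @^-1` (C1 `*` C2) = S s @^-1` C2 `&` capX [set k] (fun=> C1).
    apply/seteqP; split => w /=.
      by move=> [/= w1 w2]; split => // i /=; rewrite inE => /eqP ->.
    by move=> [w2 wE]; split => //=; apply: wE; rewrite /= inE.
  rewrite ih//; last first.
    by move=> i si; rewrite inE; apply: contraNneq ks => <-.
  rewrite /capX mX// big_set1 [RHS]muleC muleA; congr (_ * _)%E.
have mC : measurable [set x : R * R | A (g k x.1 + x.2)].
  have mh : measurable_fun setT (fun x : R * R => g k x.1 + x.2).
    by apply: measurable_funD => //; exact: measurableT_comp.
  by rewrite -[X in measurable X]setTI; exact: mh.
have := key _ mC.
rewrite /m1 /m2 /mscale /distribution /pushforward /mrestr /= -/E => e.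
transitivity (P (XS @^-1` [set x | A (g k x.1 + x.2)] `&` E)).
  by congr (P (_ `&` _)); apply/seteqP; split => w; rewrite /preimage/= /S big_cons.
rewrite e -pE muleC; congr (P _ * _)%E.
by apply/seteqP; split => w; rewrite /preimage/= /S big_cons.
Qed.

(** A general predicate serves pairwise independence, the sum without [i], and the sum without two
    indices. *)
Lemma mutually_independent_indep2 (i : 'I_n) (Q : pred 'I_n) : ~~ Q i ->
  independent2 P (X i) (fun w => \sum_(k | Q k) g k (X k w)).
Proof.
move=> Qi A B mA mB.
pose s := [seq k <- index_enum 'I_n | Q k].
have -> : (fun w => \sum_(k | Q k) g k (X k w)) = S s.
  by apply/funext => w; rewrite /S /s big_filter.
have -> : X i @^-1` A = capX [set i] (fun=> A).
  apply/seteqP; split => w /=.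
    by move=> w1 j /=; rewrite inE => /eqP ->.
  by move=> wE; apply: wE; rewrite /= inE.
rewrite setIC mutually_independent_sum//; first by rewrite muleC.
  by rewrite filter_uniq// index_enum_uniq.
by move=> k; rewrite mem_filter inE => /andP[Qk _]; apply: contraNneq Qi => <-.
Qed.

End mutual_independence.

(** * The concentration inequality *)

Section clamp.
Context {R : realFieldType}.
Implicit Types a b x w z delta : R.

(* The randomized test function: it has slope 1 on [z - delta, z + a + delta]. *)
Definition clamp z delta a w : R :=
  Num.max (- (a / 2 + delta)) (Num.min (a / 2 + delta) (w - z - a / 2)).

Lemma clampP z delta a w : 0 < delta -> 0 <= a ->
  [\/ w <= z - delta /\ clamp z delta a w = - (a / 2 + delta),
     z - delta <= w <= z + a + delta /\ clamp z delta a w = w - z - a / 2 |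
     z + a + delta <= w /\ clamp z delta a w = a / 2 + delta].
Proof.
move=> d0 a0; rewrite /clamp.
have [h1|h1] := lerP w (z - delta).
  by apply: Or31; split => //; rewrite min_r ?max_l//; lra.
have [h2|h2] := lerP w (z + a + delta).
  by apply: Or32; split; [lra|rewrite min_r ?max_r//; lra].
by apply: Or33; split; [lra|rewrite min_l ?max_r//; lra].
Qed.

Lemma clamp_norm_le z delta a w : 0 < delta -> 0 <= a ->
  `|clamp z delta a w| <= a / 2 + delta.
Proof.
by move=> d0 a0; rewrite ler_norml; case: (clampP z w d0 a0) => -[? ->]; lra.
Qed.

(** The saturation level a/2 + delta and the midpoint z + a/2 of the ramp both move at rate 1/2 in
    a. This 1/2 cancels against s >= 1/2, which is why the remainder ends up with coefficient 1. *)
Lemma clamp_lipschitz z delta a b w : 0 < delta -> 0 <= a -> 0 <= b ->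
  `|clamp z delta a w - clamp z delta b w| <= `|a - b| / 2.
Proof.
move=> d0 a0 b0; have := ler_norm (a - b); have := ler_norm (- (a - b)).
rewrite normrN ler_norml => ? ?.
by case: (clampP z w d0 a0) => -[? ->]; case: (clampP z w d0 b0) => -[? ->]; lra.
Qed.

Lemma clamp_incr_ge0 z delta a w x : 0 < delta -> 0 <= a ->
  0 <= x * (clamp z delta a w - clamp z delta a (w - x)).
Proof.
move=> d0 a0; have [x0|x0] := lerP 0 x.
  apply: mulr_ge0 => //.
  by case: (clampP z w d0 a0) => -[? ->]; case: (clampP z (w - x) d0 a0) => -[? ->]; lra.
apply: mulr_le0; first exact: ltW.
by case: (clampP z w d0 a0) => -[? ->]; case: (clampP z (w - x) d0 a0) => -[? ->]; lra.
Qed.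

(** The ramp extends by delta beyond both ends of [z, z + a], so a step of length at most delta from
    w sees slope 1 throughout, and a longer one still gains at least delta. *)
Lemma clamp_incr_ge z delta a w x : 0 < delta -> 0 <= a -> z <= w <= z + a ->
  `|x| * Num.min delta `|x| <= x * (clamp z delta a w - clamp z delta a (w - x)).
Proof.
move=> d0 a0 /andP[zw wza].
have hmin y : Num.min delta y <= delta /\ Num.min delta y <= y.
  by rewrite !ge_min !lexx orbT.
have [x0|x0] := lerP 0 x; have := hmin `|x|.
  rewrite ger0_norm// => -[h1 h2]; apply: ler_wpM2l => //.
  by case: (clampP z w d0 a0) => -[? ->]; case: (clampP z (w - x) d0 a0) => -[? ->]; lra.
rewrite ltr0_norm// => -[h1 h2]; rewrite -[leRHS]mulrNN; apply: ler_wpM2l; first by lra.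
by case: (clampP z w d0 a0) => -[? ->]; case: (clampP z (w - x) d0 a0) => -[? ->]; lra.
Qed.

End clamp.

(** * Randomized concentration for bounded Delta and Delta_i *)

Section concentration.
Context {d} {T : measurableType d} {R : realType} (P : probability T R).
Variable n : nat.

Lemma Ex_sqr_sum (U : 'I_n -> T -> R) :
  (forall i, measurable_fun setT (U i)) ->
  (forall i, integrableR P (fun w => U i w ^+ 2)) ->
  (forall i, Ex P (U i) = 0) ->
  (forall i j, i != j -> independent2 P (U i) (U j)) ->
  integrableR P (fun w => (\sum_i U i w) ^+ 2) /\
  Ex P (fun w => (\sum_i U i w) ^+ 2) = \sum_i Ex P (fun w => U i w ^+ 2).
Proof.
move=> mU U2 U0 UU.
have UiUj i j : integrableR P (fun w => U i w * U j w) by exact: integrableRM.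
have -> : (fun w => (\sum_i U i w) ^+ 2) =
    (fun w => \sum_i \sum_j U i w * U j w).
  by apply/funext => w; rewrite expr2 big_distrlr.
have sumi i : integrableR P (fun w => \sum_j U i w * U j w).
  by apply: integrableR_sum => j _.
split; first by apply: integrableR_sum => i _.
rewrite Ex_sum//; apply: eq_bigr => i _.
rewrite Ex_sum// (bigD1 i)//= [X in _ + X]big1 ?addr0// => j ji.
rewrite Ex_indepM ?U0 ?mul0r//; last 2 first.
- by apply: integrableR_sqr.
- by apply: integrableR_sqr.
by apply: UU; rewrite eq_sym.
Qed.

Variables (xi : 'I_n -> T -> R) (delta : R).
Hypothesis mxi : forall i, measurable_fun setT (xi i).
Hypothesis xi2 : forall i, integrableR P (fun w => xi i w ^+ 2).
Hypothesis xi0 : forall i, Ex P (xi i) = 0.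
Hypothesis xi_indep : forall i j, i != j -> independent2 P (xi i) (xi j).
Hypothesis xi_var : \sum_i Ex P (fun w => xi i w ^+ 2) <= 1.
Hypothesis delta0 : 0 < delta.

Let W w : R := \sum_i xi i w.
Let eta i w : R := `|xi i w| * Num.min delta `|xi i w|.
Let S w : R := \sum_i eta i w.

Let eta_norm i w : `|eta i w| <= delta * `|xi i w|.
Proof.
rewrite /eta ger0_norm; last by rewrite mulr_ge0// le_min normr_ge0 ltW.
by rewrite mulrC ler_wpM2r// ge_min lexx.
Qed.

Let h (x : R) : R := `|x| * Num.min delta `|x|.

Let mh : measurable_fun [set: R] h.
Proof.
apply: measurable_funM; first exact: normr_measurable.
by apply: measurable_minr => //; exact: normr_measurable.
Qed.

Let meta i : measurable_fun setT (eta i).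
Proof. exact: (measurableT_comp mh (mxi i)). Qed.

Let eta2 i : integrableR P (fun w => eta i w ^+ 2).
Proof.
apply: (integrableR_le _ (integrableRZ (delta ^+ 2) (xi2 i))).
  exact: measurable_funX.
move=> w; rewrite normrX -exprMn normrX lerXn2r ?nnegrE//.
by apply: le_trans (eta_norm i w) _; rewrite normrM (ger0_norm (ltW delta0)).
Qed.

Let etai i : integrableR P (eta i).
Proof. exact: integrableR_sqr. Qed.

Let s := \sum_i Ex P (eta i).

(** The summands of S are pairwise independent with 0 <= eta_i <= delta |xi_i|, so Var S <= sum_i E
    eta_i^2 <= delta^2 sum_i E xi_i^2. *)
Lemma Ex_sqr_dev_le : integrableR P (fun w => (S w - s) ^+ 2) /\
  Ex P (fun w => (S w - s) ^+ 2) <= delta ^+ 2.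
Proof.
pose V i w := eta i w - Ex P (eta i).
have -> : (fun w => (S w - s) ^+ 2) = (fun w => (\sum_i V i w) ^+ 2).
  by apply/funext => w; rewrite /S /s /V -sumrB.
have Vi i : integrableR P (V i) by apply: integrableRB => //; exact: integrableR_cst.
have V2E i : (fun w => V i w ^+ 2) = (fun w =>
    eta i w ^+ 2 - (2 * Ex P (eta i)) * eta i w + Ex P (eta i) ^+ 2).
  by apply/funext => w; rewrite /V; ring.
have V2 i : integrableR P (fun w => V i w ^+ 2).
  rewrite V2E; apply: integrableRD; last exact: integrableR_cst.
  by apply: integrableRB => //; exact: integrableRZ.
have [||||? ->] := @Ex_sqr_sum V.
- by move=> i; exact: integrableR_measurable (Vi i).
- exact: V2.
- by move=> i; rewrite /V ExB// ?Ex_cst ?subrr//; exact: integrableR_cst.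
- move=> i j ij; have mu k : measurable_fun [set: R] (fun x => h x - Ex P (eta k)).
    by apply: measurable_funB.
  exact: (independent2_comp (mu i) (mu j) (xi_indep ij)).
split => //; apply: (@le_trans _ _ (\sum_i delta ^+ 2 * Ex P (fun w => xi i w ^+ 2))).
  apply: ler_sum => i _; rewrite V2E ExD ?ExB ?Ex_cst ?ExZ//; first last.
  - exact: integrableR_cst.
  - by apply: integrableRB => //; exact: integrableRZ.
  - exact: integrableRZ.
  apply: (@le_trans _ _ (Ex P (fun w => eta i w ^+ 2))).
    by have := sqr_ge0 (Ex P (eta i)); lra.
  rewrite -ExZ//; apply: Ex_le => //; first exact: integrableRZ.
  move=> w; rewrite -[leLHS]real_normK ?num_real// -exprMn -[leRHS]real_normK ?num_real//.
  rewrite lerXn2r ?nnegrE//; apply: le_trans (eta_norm i w) _.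
  by rewrite normrM (ger0_norm (ltW delta0)).
by rewrite -mulr_sumr ler_piMr ?sqr_ge0.
Qed.

Variables (D : T -> R) (D_ : 'I_n -> T -> R) (z K : R).
Hypothesis mD : measurable_fun setT D.
Hypothesis mD_ : forall i, measurable_fun setT (D_ i).
Hypothesis D0K : forall w, 0 <= D w <= K.
Hypothesis D_0K : forall i w, 0 <= D_ i w <= K.
Hypothesis D_indep : forall i,
  independent2 P (xi i) (fun w => (D_ i w, W w - xi i w)).
Hypothesis s_ge : 2^-1 <= s.

Let A := [set w | z <= W w <= z + D w].

Let mW : measurable_fun setT W.
Proof. exact: measurable_sum. Qed.

Let mA : measurable A.
Proof.
by apply: measurable_between => //; exact: measurable_funD.
Qed.

Let mclamp : measurable_fun setT (fun x : R * R => clamp z delta x.1 x.2).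
Proof.
rewrite /clamp; have m1 : measurable_fun setT (fun x : R * R => x.1 / 2 + delta).
  by apply: measurable_funD => //; apply: measurable_funM.
apply: measurable_maxr; first exact: (measurableT_comp (@oppr_measurable R setT)).

apply: measurable_minr => //; apply: measurable_funB; last exact: measurable_funM.
exact: measurable_funB.
Qed.

(** The whole argument before taking expectations: on the left, the term linear in [S w - s] and the
    sum of products have mean zero. *)
Let pointwise w :
  s * \1_A w + 2^-1 * (S w - s) - (4 * delta)^-1 * (S w - s) ^+ 2 - delta / 4
    + \sum_i xi i w * clamp z delta (D_ i w) (W w - xi i w)
  <= 2^-1 * `|W w * D w| + (delta / 2 + delta / 2 * W w ^+ 2)
     + 2^-1 * \sum_i `|xi i w * (D w - D_ i w)|.
Proof.
have /andP[D0 DK] := D0K w.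
(* Summand by summand, f_D(W) is split as [f_D(W) - f_D(W - xi_i)] +
   [f_D(W - xi_i) - f_{D_i}(W - xi_i)] + f_{D_i}(W - xi_i); [F1] bounds the first bracket below,
   [F2] bounds the second, and the third is kept. *)
have H1 : \sum_i (\1_A w * eta i w - 2^-1 * `|xi i w * (D w - D_ i w)|
    + xi i w * clamp z delta (D_ i w) (W w - xi i w)) <= W w * clamp z delta (D w) (W w).
  rewrite {3}/W mulr_suml; apply: ler_sum => i _.
  have /andP[Di0 DiK] := D_0K i w.
  have F1 : \1_A w * eta i w <=
      xi i w * (clamp z delta (D w) (W w) - clamp z delta (D w) (W w - xi i w)).
    rewrite indicE; have [wA|wA] := boolP (w \in A).
      by rewrite mul1r; apply: clamp_incr_ge => //; move: wA; rewrite inE.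
    by rewrite mul0r; exact: clamp_incr_ge0.
  have F2 : `|xi i w * (clamp z delta (D w) (W w - xi i w)
      - clamp z delta (D_ i w) (W w - xi i w))| <= 2^-1 * `|xi i w * (D w - D_ i w)|.
    rewrite !normrM mulrCA ler_wpM2l// mulrC; exact: clamp_lipschitz.
  move: F2; rewrite ler_norml => /andP[F2 _].
  lra.
have H2 : W w * clamp z delta (D w) (W w) <=
    2^-1 * `|W w * D w| + (delta / 2 + delta / 2 * W w ^+ 2).
  apply: (le_trans (ler_norm _)); rewrite normrM.
  apply: (@le_trans _ _ (`|W w| * (D w / 2 + delta))).
    by rewrite ler_wpM2l// clamp_norm_le.
  rewrite normrM (ger0_norm D0) -[W w ^+ 2]real_normK ?num_real//.
  have : 0 <= delta * (`|W w| - 1) ^+ 2 by rewrite mulr_ge0 ?sqr_ge0 ?ltW.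
  by nra.
(* 1_A (S - s) >= -(S - s)^- = ((S - s) - |S - s|)/2. The centred linear term is kept because its
   mean is zero, which halves the loss; |S - s| is then bounded by AM-GM with weight delta. *)
have H3 : s * \1_A w + 2^-1 * (S w - s) - (4 * delta)^-1 * (S w - s) ^+ 2 - delta / 4
    <= \1_A w * S w.
  have q : (4 * delta)^-1 * (S w - s) ^+ 2 + delta / 4 >= 2^-1 * `|S w - s|.
    rewrite -subr_ge0 -[(S w - s) ^+ 2]real_normK ?num_real//.
    have -> : (4 * delta)^-1 * `|S w - s| ^+ 2 + delta / 4 - 2^-1 * `|S w - s| =
      (4 * delta)^-1 * (`|S w - s| - delta) ^+ 2.
      by field; rewrite gt_eqF.
    by apply: mulr_ge0; [rewrite invr_ge0 mulr_ge0// ltW|exact: sqr_ge0].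
  have n1 := ler_norm (S w - s); have := ler_norm (- (S w - s)); rewrite normrN => n2.
  set u := (4 * delta)^-1 * (S w - s) ^+ 2 in q *.
  rewrite indicE; case: (w \in A); rewrite ?mulr1 ?mul1r ?mulr0 ?mul0r.
    lra.
  lra.
move: H1; rewrite big_split/= sumrB -!mulr_sumr -/(S w) => H1.
lra.
Qed.

(** The variance is only asked to be at most 1, so that the inequality also covers families with
    some summands replaced by 0. *)
Lemma concentration : Ex P (\1_A) <= 3 * delta + Ex P (fun w => `|W w * D w|)
    + \sum_i Ex P (fun w => `|xi i w * (D w - D_ i w)|).
Proof.
have intxi i : integrableR P (xi i) by exact: integrableR_sqr.
have [W2 EW2] := Ex_sqr_sum mxi xi2 xi0 xi_indep.
have [S2 ES2] := Ex_sqr_dev_le.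
have D_bound w : `|D w| <= K by have /andP[? ?] := D0K w; rewrite ger0_norm.
have D__bound i w : `|D_ i w| <= K by have /andP[? ?] := D_0K i w; rewrite ger0_norm.
have Wi : integrableR P W by exact: integrableR_sum.
have Si : integrableR P S by exact: integrableR_sum.
have Ai : integrableR P \1_A by exact: integrableR_indic.
have WDi : integrableR P (fun w => `|W w * D w|).
  apply: integrableR_norm; exact: integrableRM_bounded D_bound.
have Ui i : integrableR P (fun w => `|xi i w * (D w - D_ i w)|).
  apply/integrableR_norm/(@integrableRM_bounded _ _ _ _ (K + K)) => //.
    exact: measurable_funB.
  by move=> w; rewrite (le_trans (ler_normB _ _))// lerD.
pose V i w := clamp z delta (D_ i w) (W w - xi i w).
have mDW i : measurable_fun setT (fun w => (D_ i w, W w - xi i w)).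
  by apply/measurable_fun_pair => //; exact: measurable_funB.
have mV i : measurable_fun setT (V i) by exact: (measurableT_comp mclamp (mDW i)).
have V_bound i w : `|V i w| <= K / 2 + delta.
  have /andP[D_0 D_K] := D_0K i w.
  by apply: (le_trans (clamp_norm_le _ _ delta0 D_0)); lra.
have Vi i : integrableR P (V i) by exact: integrableR_bounded (V_bound i).
have xiVi i : integrableR P (fun w => xi i w * V i w).
  exact: integrableRM_bounded (V_bound i).
have xiV0 i : Ex P (fun w => xi i w * V i w) = 0.
  rewrite Ex_indepM ?xi0 ?mul0r//.
  exact: (independent2_comp (@measurable_id _ _ setT) mclamp (D_indep i)).
have Lsum : integrableR P (fun w => \sum_i xi i w * V i w) by exact: integrableR_sum.
have Rsum : integrableR P (fun w => \sum_i `|xi i w * (D w - D_ i w)|).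
  by apply: integrableR_sum.
have L1 : integrableR P (fun w => s * \1_A w) by exact: integrableRZ.
have L2 : integrableR P (fun w => 2^-1 * (S w - s)).
  by apply/integrableRZ/integrableRB => //; exact: integrableR_cst.
have L3 : integrableR P (fun w => (4 * delta)^-1 * (S w - s) ^+ 2).
  exact: integrableRZ.
have c4 := integrableR_cst P (delta / 4).
have c2 := integrableR_cst P (delta / 2).
have R1 : integrableR P (fun w => 2^-1 * `|W w * D w|) by exact: integrableRZ.
have R2 : integrableR P (fun w => delta / 2 * W w ^+ 2) by exact: integrableRZ.
have R3 : integrableR P (fun w => 2^-1 * \sum_i `|xi i w * (D w - D_ i w)|).
  exact: integrableRZ.
have L12 := integrableRD L1 L2.
have L123 := integrableRB L12 L3.
have L1234 := integrableRB L123 c4.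
have R22 := integrableRD c2 R2.
have R12 := integrableRD R1 R22.
have := Ex_le (integrableRD L1234 Lsum) (integrableRD R12 R3) pointwise.
rewrite (ExD L1234 Lsum) (ExB L123 c4) (ExB L12 L3) (ExD L1 L2).
rewrite (ExD R12 R3) (ExD R1 R22) (ExD c2 R2) !Ex_cst.
rewrite (ExZ _ Ai) (ExZ _ S2) (ExZ _ W2) (ExZ _ WDi) (ExZ _ Rsum) EW2.
rewrite ExZ; last by apply: integrableRB => //; exact: integrableR_cst.
rewrite ExB//; last exact: integrableR_cst.
have -> : Ex P S = s by exact: Ex_sum.
have -> : Ex P (fun w => \sum_i xi i w * V i w) = 0.
  by rewrite Ex_sum// big1.
rewrite Ex_cst subrr mulr0 !addr0 (Ex_sum _ (fun i _ => Ui i)).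
(* Losses: delta/4 twice from S, and delta/2 twice from |W| <= (1 + W^2)/2. They add up to 3 delta /
   2, and s >= 1/2 doubles this. *)
have dS : (4 * delta)^-1 * Ex P (fun w => (S w - s) ^+ 2) <= delta / 4.
  rewrite -(@ler_pM2l _ (4 * delta)) ?mulr_gt0// mulrA mulfV ?mul1r; last first.
    by rewrite gt_eqF ?mulr_gt0.
  by apply: le_trans ES2 _; rewrite expr2; lra.
have dW : delta / 2 * (\sum_i Ex P (fun w => xi i w ^+ 2)) <= delta / 2.
  by rewrite ler_piMr// divr_ge0// ltW.
have sA : 2^-1 * Ex P \1_A <= s * Ex P \1_A.
  by rewrite ler_wpM2r// Ex_ge0.
lra.
Qed.

End concentration.

(** * Truncation and one-sided comparison *)

Lemma lee_abs_sub (R : realType) (a b x : \bar R) :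
  a \is a fin_num -> b \is a fin_num ->
  (a <= b + x -> b <= a + x -> `|a - b| <= x)%E.
Proof.
move: a b x => [a| |] [b| |] [x| |] //= _ _.
- by rewrite !lee_fin ler_norml => ? ?; lra.
- by move=> _ _; rewrite leey.
Qed.

Section randomized_concentration.
Context {d} {T : measurableType d} {R : realType} (P : probability T R).
Variables (n : nat) (xi : 'I_n -> T -> R) (delta : R).
Hypothesis mxi : forall i, measurable_fun setT (xi i).
Hypothesis xi2 : forall i, integrableR P (fun w => xi i w ^+ 2).
Hypothesis xi0 : forall i, Ex P (xi i) = 0.
Hypothesis xi_indep : forall i j, i != j -> independent2 P (xi i) (xi j).
Hypothesis xi_var : \sum_i Ex P (fun w => xi i w ^+ 2) <= 1.
Hypothesis delta0 : 0 < delta.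
Variables (D : T -> R) (D_ : 'I_n -> T -> R).
Hypothesis mD : measurable_fun setT D.
Hypothesis mD_ : forall i, measurable_fun setT (D_ i).
Let W w : R := \sum_i xi i w.
Hypothesis D_indep : forall i,
  independent2 P (xi i) (fun w => (D_ i w, W w - xi i w)).
Hypothesis s_ge :
  2^-1 <= \sum_i Ex P (fun w => `|xi i w| * Num.min delta `|xi i w|).

Let rem : \bar R := (\int[P]_w (`|W w * D w|)%:E +
  \sum_i \int[P]_w (`|xi i w * (D w - D_ i w)|)%:E)%E.

Let mW : measurable_fun setT W.
Proof. exact: measurable_sum. Qed.

Let trunc (K x : R) : R := Num.min `|x| K.

Let mtrunc K : measurable_fun [set: R] (trunc K).
Proof. by apply: measurable_minr => //; exact: normr_measurable. Qed.

Let trunc_lipschitz K x y : `|trunc K x - trunc K y| <= `|x - y|.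
Proof.
have := lerB_dist x y; have := lerB_dist y x; rewrite (distrC y x) => h1 h2.
by rewrite /trunc; case: (leP `|x| K) => ?; case: (leP `|y| K) => ?; rewrite ler_norml; lra.
Qed.

(* Delta and Delta_i are truncated at K: no moment of Delta_i is assumed, so
   xi_i f_{Delta_i}(W - xi_i) need not be integrable otherwise. *)
Lemma concentration_trunc z (K : R) : 0 <= K ->
  (P [set w | (z <= W w <= z + trunc K (D w))%R] <= (3 * delta)%:E + rem)%E.
Proof.
move=> K0.
have tK x : 0 <= trunc K x <= K.
  by rewrite /trunc le_min normr_ge0 K0/= ge_min lexx orbT.
have mDK : measurable_fun setT (fun w => trunc K (D w)) by exact: measurableT_comp.
have mDK_ i : measurable_fun setT (fun w => trunc K (D_ i w)) by exact: measurableT_comp.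
have DK_indep i : independent2 P (xi i) (fun w => (trunc K (D_ i w), W w - xi i w)).
  have mu : measurable_fun setT (fun x : R * R => (trunc K x.1, x.2)).
    by apply/measurable_fun_pair => //=; exact: measurableT_comp.
  exact: (independent2_comp (@measurable_id _ _ setT) mu (D_indep i)).
have mA : measurable [set w | z <= W w <= z + trunc K (D w)].
  by apply: measurable_between => //; exact: measurable_funD.
have := concentration mxi xi2 xi0 xi_indep xi_var delta0 z mDK mDK_
  (fun w => tK (D w)) (fun i w => tK (D_ i w)) DK_indep s_ge.
rewrite -lee_fin Ex_indic// => /le_trans; apply.
have Wi : integrableR P W by apply: integrableR_sum => i _; exact: integrableR_sqr.
have tnK x : `|trunc K x| <= K by have /andP[? ?] := tK x; rewrite ger0_norm.
rewrite !EFinD -addeA leeD2l//; apply: leeD.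
  rewrite -Ex_EFin; last first.
    by apply/integrableR_norm/(integrableRM_bounded _ _ Wi) => // w; exact: tnK.
  apply: ge0_le_integral => //.
  - by apply/measurable_EFinP/measurableT_comp => //; exact: measurable_funM.
  - by apply/measurable_EFinP/measurableT_comp => //; exact: measurable_funM.
  - move=> w _; rewrite lee_fin !normrM ler_wpM2l//.
    by rewrite /trunc [leLHS]ger0_norm ?ge_min ?lexx// le_min normr_ge0.
rewrite -sumEFin lee_sum// => i _; rewrite -Ex_EFin; last first.
  apply/integrableR_norm/(@integrableRM_bounded _ _ _ _ (K + K)) => //.
  - exact: measurable_funB.
  - exact: integrableR_sqr.
  - by move=> w; rewrite (le_trans (ler_normB _ _))// lerD.
apply: ge0_le_integral => //.
- apply/measurable_EFinP/measurableT_comp => //; apply: measurable_funM => //.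
  exact: measurable_funB.
- apply/measurable_EFinP/measurableT_comp => //; apply: measurable_funM => //.
  exact: measurable_funB.
- by move=> w _; rewrite lee_fin !normrM ler_wpM2l.
Qed.

(** The bound at truncation level K does not involve K, and the truncated events increase to the
    full one: continuity from below. *)
Lemma randomized_concentration z :
  (P [set w | (z <= W w <= z + `|D w|)%R] <= (3 * delta)%:E + rem)%E.
Proof.
pose F (k : nat) := [set w | z <= W w <= z + trunc k%:R (D w)].
have mF k : measurable (F k).
  apply: measurable_between => //; apply: measurable_funD => //.
  exact: measurableT_comp.
have -> : [set w | z <= W w <= z + `|D w|] = \bigcup_k F k.
  apply/seteqP; split => w /=.
    move=> /andP[zW WD]; have [k Dk] : exists k : nat, `|D w| <= k%:R.
      by exists (Num.bound `|D w|); rewrite ltW// archi_boundP.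
    by exists k => //; rewrite /F/= zW /trunc min_l.
  move=> [k _]; rewrite /F /trunc/= => /andP[-> Wk].
  by rewrite (le_trans Wk)// lerD2l ge_min lexx.
have ndF : nondecreasing_seq F.
  move=> k l kl; apply/subsetPset => w; rewrite /F/= => /andP[-> Wk].
  rewrite (le_trans Wk)// lerD2l /trunc le_min ge_min lexx/= ge_min.
  by rewrite ler_nat kl orbT.
have cF := @nondecreasing_cvg_mu _ _ _ P F mF (bigcup_measurable (fun k _ => mF k)) ndF.
rewrite -(cvg_lim _ cF)//; apply: lime_le; first by apply/cvg_ex; eexists; exact: cF.
by apply: nearW => k; exact: concentration_trunc.
Qed.

End randomized_concentration.

(** The two events differ only when W lies within |D| of z. The case W >= z is the concentration
    inequality; the case W <= z is the same inequality for the variables - xi_i at - z, with [D] and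
    [D_] unchanged since the remainder only sees absolute values. *)
Lemma cdf_dist_le d (T : measurableType d) (R : realType) (P : probability T R)
    (n : nat) (xi : 'I_n -> T -> R) (delta : R) (V : T -> R) (D_ : 'I_n -> T -> R) :
  let W w := \sum_i xi i w in
  let D w := V w - W w in
  (forall i, measurable_fun setT (xi i)) ->
  (forall i, integrableR P (fun w => xi i w ^+ 2)) ->
  (forall i, Ex P (xi i) = 0) ->
  (forall i j, i != j -> independent2 P (xi i) (xi j)) ->
  \sum_i Ex P (fun w => xi i w ^+ 2) <= 1 ->
  0 < delta ->
  measurable_fun setT V ->
  (forall i, measurable_fun setT (D_ i)) ->
  (forall i, independent2 P (xi i) (fun w => (D_ i w, W w - xi i w))) ->
  2^-1 <= \sum_i Ex P (fun w => `|xi i w| * Num.min delta `|xi i w|) ->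
  forall z,
  (`|P [set w | (V w <= z)%R] - P [set w | (W w <= z)%R]| <=
    (3 * delta)%:E + (\int[P]_w (`|W w * D w|)%:E +
      \sum_i \int[P]_w (`|xi i w * (D w - D_ i w)|)%:E))%E.
Proof.
move=> W D mxi xi2 xi0 xi_indep xi_var delta0 mV mD_ D_indep s_ge z.
have mW : measurable_fun setT W by exact: measurable_sum.
have mD : measurable_fun setT D by exact: measurable_funB.
have mleV : measurable [set w | V w <= z] by exact: measurable_le_set.
have mleW : measurable [set w | W w <= z] by exact: measurable_le_set.
have mN : measurable_fun [set: R] -%R by exact: oppr_measurable.
have sub_le A B C : measurable A -> measurable B -> measurable C ->
    A `<=` B `|` C -> (P A <= P B + P C)%E.
  move=> mA mB mC ABC; apply: le_trans (measureU2 _ mB mC).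
  by apply: le_measure; rewrite ?inE//; exact: measurableU.
apply: lee_abs_sub; [exact: fin_num_measure|exact: fin_num_measure|..].
  have mA : measurable [set w | z <= W w <= z + `|D w|].
    apply: measurable_between => //; apply: measurable_funD => //.
    exact: measurableT_comp.
  have := randomized_concentration mxi xi2 xi0 xi_indep xi_var delta0 mD mD_ D_indep s_ge z.
  rewrite -/W -/D => h; apply: le_trans (leeD2l _ h); apply: sub_le => //= w /=.
  move=> Vz; have [Wz|Wz] := leP (W w) z; [by left|right].
  by rewrite ltW//= -/(W w) /D; have := ler_norm (- (V w - W w)); rewrite normrN; lra.
pose N i w := - xi i w.
have mNxi i : measurable_fun setT (N i) by exact: measurableT_comp.
have N2 i : (fun w => N i w ^+ 2) = (fun w => xi i w ^+ 2).
  by apply/funext => w; rewrite /N sqrrN.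
have Nxi2 i : integrableR P (fun w => N i w ^+ 2) by rewrite N2.
have Nxi0 i : Ex P (N i) = 0.
  have -> : N i = (fun w => -1 * xi i w) by apply/funext => w; rewrite mulN1r.
  by rewrite ExZ ?xi0 ?mulr0//; exact: integrableR_sqr.
have Nindep i j : i != j -> independent2 P (N i) (N j).
  by move=> ij; exact: (independent2_comp mN mN (xi_indep _ _ ij)).
have Nvar : \sum_i Ex P (fun w => N i w ^+ 2) <= 1.
  by under eq_bigr do rewrite N2.
have Nsge : 2^-1 <= \sum_i Ex P (fun w => `|N i w| * Num.min delta `|N i w|).
  apply: le_trans s_ge _; apply: ler_sum => i _.
  by rewrite /N le_eqVlt; apply/orP; left; apply/eqP; congr (Ex P _);
    apply/funext => w; rewrite normrN.
have ND i : independent2 P (N i) (fun w => (D_ i w, \sum_j N j w - N i w)).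
  have -> : (fun w => (D_ i w, \sum_j N j w - N i w)) =
      (fun x : R * R => (x.1, - x.2)) \o (fun w => (D_ i w, W w - xi i w)).
    by apply/funext => w /=; rewrite /W /N sumrN opprB opprK addrC.
  apply: (independent2_comp mN _ (D_indep i)).
  by apply/measurable_fun_pair => //; exact: measurableT_comp.
pose A := [set w | - z <= \sum_i N i w <= - z + `|D w|].
have mA : measurable A.
  apply: measurable_between => //; first exact: measurable_sum.
  by apply: measurable_funD => //; exact: measurableT_comp.
have := randomized_concentration mNxi Nxi2 Nxi0 Nindep Nvar delta0 mD mD_ ND Nsge (- z).
under eq_integral do rewrite sumrN mulNr normrN.
under eq_bigr do under eq_integral do rewrite /N mulNr normrN.
rewrite -/A => h; apply: le_trans (leeD2l _ h); apply: sub_le => //= w /=.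
move=> Wz; have [Vz|Vz] := leP (V w) z; [by left|right].
rewrite /A/= sumrN -/(W w) lerN2 Wz/= /D.
by have := ler_norm (V w - W w); lra.
Qed.

(** * The Stein equation *)

Section normal_cdf.
Context {R : realType}.
Implicit Types x y z w u v : R.

Let MVT_le (f df : R -> R) (a b : R) : a <= b ->
  (forall x, a <= x <= b -> is_derive x 1 f (df x)) ->
  exists2 c, a <= c <= b & f b - f a = df c * (b - a).
Proof.
move=> ab fdf; have [||c cab ->] := @MVT_segment R f df a b ab.
- by move=> x; rewrite in_itv/= => /andP[? ?]; apply: fdf; rewrite !ltW.
- apply: derivable_within_continuous => x; rewrite in_itv/= => xab.
  by have [] := fdf _ xab.
- by exists c.
Qed.

Definition ndf x : R := normal_pdf 0 1 x.

Definition ncdf x : R := fine (Phi x).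

Lemma ncdf_EFin x : Phi x = (ncdf x)%:E.
Proof. by rewrite /ncdf fineK// /Phi fin_num_measure. Qed.

Lemma ndf_gt0 x : 0 < ndf x.
Proof.
by rewrite /ndf normal_pdfE ?oner_neq0// mulr_gt0 ?normal_peak_gt0 ?oner_neq0 ?expR_gt0.
Qed.

Lemma ndfN x : ndf (- x) = ndf x.
Proof.
rewrite /ndf normal_pdfE ?oner_neq0//; congr (_ * _).
by rewrite /normal_fun !subr0 sqrrN.
Qed.

Lemma is_derive_ndf x : is_derive x 1 ndf (- x * ndf x).
Proof.
have -> : ndf = (fun x => normal_peak 1 * expR (- (x ^+ 2 / 2))).
  apply/funext => y; rewrite /ndf normal_pdfE ?oner_neq0//; congr (_ * expR _).
  by rewrite subr0 expr1n mulNr.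
apply: is_derive_eq; rewrite /GRing.scale/=; by field.
Qed.

Lemma is_derive_ncdf x : is_derive x 1 ncdf (ndf x).
Proof.
have [||||dF F'] := @continuous_FTC1 R ndf -oo%O x (x + 1).
- by rewrite ltrDl.
- by apply: integrableS (integrable_normal_pdf 0 1).
- by rewrite ltNyr.
- by apply: continuous_normal_pdf; exact: oner_neq0.
by apply: (DeriveDef dF); rewrite -derive1E.
Qed.

Lemma ncdf_ge0 x : 0 <= ncdf x.
Proof. by rewrite /ncdf fine_ge0. Qed.

Lemma ncdf_le1 x : ncdf x <= 1.
Proof. by rewrite -lee_fin -ncdf_EFin; exact: probability_le1. Qed.

Lemma cvg_ndfNy : ndf x @[x --> -oo] --> (0 : R).
Proof.
(* (x + 1)^2 >= 0 gives - x^2/2 <= 1/2 + x, so the density is dominated by a multiple of exp(x). *)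
have e0 : normal_peak 1 * expR 2^-1 * expR x @[x --> -oo] --> (0 : R).
  rewrite -[X in _ --> X](mulr0 (normal_peak 1 * expR 2^-1)).
  by apply: cvgMr; apply/cvgNy_compNP; exact: cvgr_expR.
apply: (squeeze_cvgr _ (cvg_cst 0) e0); apply: nearW => x.
rewrite ltW ?ndf_gt0//= /ndf normal_pdfE ?oner_neq0// -mulrA ler_wpM2l ?normal_peak_ge0//.
rewrite -expRD ler_expR subr0 expr1n; have := sqr_ge0 (x + 1).
by rewrite sqrrD; lra.
Qed.

(** The identity, seen as a random variable under the normal law, has [Phi] as its distribution
    function; this yields the limits at both infinities. *)
Let idTR : measurableTypeR R -> R := idfun.

HB.instance Definition _ :=
  @isMeasurableFun.Build _ _ _ _ idTR (@measurable_id _ _ setT).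

Let idRV : {RV (normal_prob (0 : R) 1) >-> R} := idTR.

Lemma cvg_ncdfNy : ncdf x @[x --> -oo] --> (0 : R).
Proof. by apply: fine_cvg; exact: (cvg_cdfNy0 idRV). Qed.

Lemma cvg_ncdfy : ncdf x @[x --> +oo] --> (1 : R).
Proof. by apply: fine_cvg; exact: (cvg_cdfy1 idRV). Qed.

(** The sum of the two values has derivative 0 because the density is even, and tends to 1 + 0 at
    +oo. *)
Lemma ncdfN x : ncdf (- x) = 1 - ncdf x.
Proof.
pose F y := ncdf y + ncdf (- y).
have dF y : is_derive y 1 F 0.
  have d1 := is_derive_ncdf y; have d2 := is_derive_ncdf (- y).
  have d3 : is_derive y 1 (ncdf \o -%R) (- ndf (- y)).
    by apply: is_derive_eq; rewrite mulrN1.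
  have -> : F = ncdf + (ncdf \o -%R) by [].
  by apply: is_derive_eq; rewrite ndfN subrr.
have F1 : F x = 1.
  have : F y @[y --> +oo] --> (1 + 0 : R).
    by apply: cvgD; [exact: cvg_ncdfy|exact: ((cvgNy_compNP ncdf _).1 cvg_ncdfNy)].
  have -> : F = cst (F x) by apply/funext => y; exact: is_derive_0_is_cst.
  by rewrite addr0; move/(cvg_unique _ (cvg_cst (F x))) => ->.
by rewrite -F1 /F addrC addKr.
Qed.

Lemma ndecr_cvg0_ge0 (F dF : R -> R) b :
  (forall x, x <= b -> is_derive x 1 F (dF x)) ->
  (forall x, x <= b -> 0 <= dF x) ->
  F x @[x --> -oo] --> (0 : R) -> 0 <= F b.
Proof.
move=> FdF dF0 F0; apply: (cvgr_to_le F0).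
near=> y.
have yb : y <= b by near: y; by apply: nbhs_ninfty_le; exact: num_real.
have [|c /andP[_ cb] FF] := MVT_le yb (_ : forall x, _ -> is_derive x 1 F (dF x)).
  by move=> x /andP[_]; exact: FdF.
by rewrite -subr_ge0 FF mulr_ge0 ?dF0// subr_ge0.
Unshelve. all: by end_near. Qed.

(** For w < 0 this is the classical bound Phi(w) >= |w| phi(w) / (1 + w^2). Divided by 1 + w^2, the
    left side vanishes at -oo and has derivative 2 phi / (1 + w^2)^2. It is the sign of the
    derivative of w Phi(w) / phi(w). *)
Lemma ncdf_mills_lb w : 0 <= (1 + w ^+ 2) * ncdf w + w * ndf w.
Proof.
have q0 x : 1 + x ^+ 2 != 0 by rewrite gt_eqF// ltr_wpDr ?sqr_ge0.
pose F x := ncdf x + x * ndf x * (1 + x ^+ 2)^-1.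
suff : 0 <= F w.
  move=> F0; rewrite (_ : _ + _ = (1 + w ^+ 2) * F w).
    by rewrite mulr_ge0// addr_ge0 ?sqr_ge0.
  by rewrite /F; field.
apply: (@ndecr_cvg0_ge0 F (fun x => 2 * ndf x / (1 + x ^+ 2) ^+ 2)).
- move=> x _; have d1 := is_derive_ncdf x; have d2 := is_derive_ndf x.
  have d3 : is_derive x 1 (fun y => (1 + y ^+ 2)^-1) (- (2 * x) / (1 + x ^+ 2) ^+ 2).
    by apply: is_derive_eq; rewrite /GRing.scale/=; field; exact: q0.
  by apply: is_derive_eq; rewrite /GRing.scale/=; field; exact: q0.
- by move=> x _; rewrite divr_ge0 ?sqr_ge0 ?mulr_ge0 ?ltW ?ndf_gt0.
- have e0 : ncdf x + ndf x @[x --> -oo] --> (0 : R).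
    by rewrite -[X in _ --> X]addr0; apply: cvgD; [exact: cvg_ncdfNy|exact: cvg_ndfNy].
  have e1 : - ndf x @[x --> -oo] --> (0 : R).
    by rewrite -[X in _ --> X]oppr0; apply: cvgN; exact: cvg_ndfNy.
  apply: (squeeze_cvgr _ e1 e0); apply: nearW => x.
  have : `|x * ndf x * (1 + x ^+ 2)^-1| <= ndf x.
    rewrite normrM normfV (@ger0_norm _ (1 + _)) ?addr_ge0 ?sqr_ge0//.
    rewrite ler_pdivrMr ?ltr_wpDr ?sqr_ge0//.
    rewrite normrM (gtr0_norm (ndf_gt0 x)) mulrC ler_pM2l ?ndf_gt0//.
    rewrite -[x ^+ 2]real_normK ?num_real//; have := sqr_ge0 (`|x| - 1).
    by have := normr_ge0 x; nra.
  rewrite ler_norml /F => /andP[h1 h2]; have := ncdf_ge0 x.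
  by move: h1 h2; move: (x * _ * _) => v; lra.
Qed.

(** For w < 0 this is Phi(w) <= phi(w) / |w|; the difference of the two sides vanishes at -oo and
    has derivative phi(w) / w^2. It is the sign of the derivative of [mills]. *)
Lemma ncdf_mills_ub w : 0 <= ndf w + w * ncdf w.
Proof.
have [w0|w0] := leP 0 w.
  by rewrite addr_ge0 ?mulr_ge0 ?ncdf_ge0// ltW ?ndf_gt0.
pose F x := - x^-1 * ndf x - ncdf x.
suff : 0 <= F w.
  move=> F0; rewrite (_ : _ + _ = - w * F w).
    by rewrite mulr_ge0// oppr_ge0 ltW.
  by rewrite /F; field; rewrite lt_eqF.
apply: (@ndecr_cvg0_ge0 F (fun x => ndf x / x ^+ 2)).
- move=> x xw; have d1 := is_derive_ncdf x; have d2 := is_derive_ndf x.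
  have x0 : x != 0 by rewrite lt_eqF// (le_lt_trans xw).
  have d3 : is_derive x 1 (fun y => y^-1) (- x ^- 2).
    apply: is_derive_eq; first exact: (is_deriveV (f := id)).
    by rewrite /GRing.scale/= mulr1.
  by apply: is_derive_eq; rewrite /GRing.scale/=; field; exact: x0.
- by move=> x _; rewrite divr_ge0 ?sqr_ge0 ?ltW ?ndf_gt0.
- have e1 : - ncdf x @[x --> -oo] --> (0 : R).
    by rewrite -[X in _ --> X]oppr0; apply: cvgN; exact: cvg_ncdfNy.
  apply: (squeeze_cvgr _ e1 cvg_ndfNy); near=> x.
  have x1 : x <= -1 by near: x; apply: nbhs_ninfty_le; exact: num_real.
  have h0 : 0 <= - x^-1 by rewrite -invrN invr_ge0; lra.
  have h1 : - x^-1 <= 1 by rewrite -invrN invf_le1; lra.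
  have := ncdf_ge0 x; have := ndf_gt0 x; rewrite /F; nra.
Unshelve. all: by end_near. Qed.

(** The Mills ratio (1 - Phi) / phi taken at - w. *)
Definition mills w : R := ncdf w / ndf w.

Lemma mills_ge0 w : 0 <= mills w.
Proof. by rewrite divr_ge0 ?ncdf_ge0// ltW ?ndf_gt0. Qed.

Lemma is_derive_mills w : is_derive w 1 mills (1 + w * mills w).
Proof.
have p0 : ndf w != 0 by rewrite gt_eqF ?ndf_gt0.
have d1 := is_derive_ncdf w; have d2 := is_derive_ndf w.
have d3 : is_derive w 1 (fun y => (ndf y)^-1) (- (- w * ndf w) / ndf w ^+ 2).
  by apply: is_derive_eq; rewrite /GRing.scale/=; field.
by apply: is_derive_eq; rewrite /GRing.scale/= /mills; field.
Qed.

Lemma mills_ub w : 0 <= 1 + w * mills w.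
Proof.
rewrite (_ : _ + _ = (ndf w + w * ncdf w) / ndf w).
  by rewrite divr_ge0 ?ncdf_mills_ub// ltW ?ndf_gt0.
by rewrite /mills; field; rewrite gt_eqF ?ndf_gt0.
Qed.

Lemma nondecreasing_mills : {homo mills : u v / u <= v}.
Proof.
move=> u v uv; have [|c _ e] := MVT_le uv (_ : forall x, _ ->
    is_derive x 1 mills (1 + x * mills x)).
  by move=> x _; exact: is_derive_mills.
by rewrite -subr_ge0 e mulr_ge0 ?mills_ub// subr_ge0.
Qed.

Lemma nondecreasing_id_mills : {homo (fun w => w * mills w) : u v / u <= v}.
Proof.
move=> u v uv.
have [|c _ e] := MVT_le uv (_ : forall x, _ ->
    is_derive x 1 (fun w => w * mills w) ((1 + x ^+ 2) * mills x + x)).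
  move=> x _; have d1 := is_derive_mills x.
  by apply: is_derive_eq; rewrite /GRing.scale/=; ring.
rewrite -subr_ge0 e mulr_ge0 ?subr_ge0//.
rewrite (_ : _ + _ = ((1 + c ^+ 2) * ncdf c + c * ndf c) / ndf c).
  by rewrite divr_ge0 ?ncdf_mills_lb// ltW ?ndf_gt0.
by rewrite /mills; field; rewrite gt_eqF ?ndf_gt0.
Qed.

(** * The solution of the Stein equation and its increments *)

Variable z : R.
Let c := ncdf z.

(* Solution of f'(w) - w f(w) = 1(w <= z) - c. *)
Definition stein_sol w : R :=
  if w <= z then (1 - c) * mills w else c * mills (- w).

(** The two branches of [stein_sol] agree at z: it is continuous there, and both one-sided formulas
    include z. *)
Let mills_z : (1 - c) * mills z = c * mills (- z).
Proof. by rewrite /mills ndfN ncdfN -/c; ring. Qed.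

Let stein_le w : w <= z -> stein_sol w = (1 - c) * mills w.
Proof. by rewrite /stein_sol => ->. Qed.

Let stein_ge w : z <= w -> stein_sol w = c * mills (- w).
Proof.
rewrite /stein_sol le_eqVlt => /predU1P[<-|zw]; first by rewrite lexx.
by rewrite leNgt zw.
Qed.

Let c0 : 0 <= c. Proof. exact: ncdf_ge0. Qed.
Let c1 : 0 <= 1 - c. Proof. by rewrite subr_ge0 ncdf_le1. Qed.

Lemma measurable_stein_sol : measurable_fun [set: R] stein_sol.
Proof.
have mm : measurable_fun [set: R] mills.
  by apply: nondecreasing_measurable => //; exact: nondecreasing_mills.
apply: measurable_fun_ifT.
- by apply: measurable_fun_ler.
- exact: measurable_funM.
- by apply: measurable_funM => //; apply: measurableT_comp => //.
Qed.

Lemma stein_sol_norm_le w : `|stein_sol w| <= mills z + mills (- z).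
Proof.
have := ncdf_le1 z; rewrite -/c => c1'.
have [wz|zw] := leP w z; [rewrite stein_le//|rewrite (stein_ge (ltW zw))].
  rewrite (ger0_norm (mulr_ge0 c1 (mills_ge0 _))); apply: (@le_trans _ _ (mills z)).
    have := nondecreasing_mills wz; have := mills_ge0 w; have := c0; nra.
  by rewrite lerDl mills_ge0.
rewrite (ger0_norm (mulr_ge0 c0 (mills_ge0 _))); apply: (@le_trans _ _ (mills (- z))).
  have : mills (- w) <= mills (- z) by apply: nondecreasing_mills; rewrite lerN2 ltW.
  have := mills_ge0 (- w); have := c0; nra.
by rewrite lerDr mills_ge0.
Qed.

Let m w := w * stein_sol w.

(** Left of z this is a nonnegative multiple of w [mills w], right of z minus such a multiple of its
    reflection; the pieces join at z. *)
Lemma nondecreasing_id_stein_sol : {homo m : u v / u <= v}.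
Proof.
have H1 u v : u <= v -> v <= z -> m u <= m v.
  move=> uv vz; rewrite /m !stein_le// ?(le_trans uv)// !(mulrCA _ (1 - c)).
  by rewrite ler_wpM2l//; exact: nondecreasing_id_mills.
have H2 u v : u <= v -> z <= u -> m u <= m v.
  move=> uv zu; rewrite /m !stein_ge// ?(le_trans zu)// !(mulrCA _ c) ler_wpM2l//.
  by rewrite -lerN2 -!mulNr; apply: nondecreasing_id_mills; rewrite lerN2.
move=> u v uv; have [vz|zv] := leP v z; first exact: H1.
have [zu|uz] := leP z u; first exact: H2.
by apply: (@le_trans _ _ (m z)); [apply: H1 => //; exact: ltW|apply: H2 => //; exact: ltW].
Qed.

(** [mills_ub] gives the lower bound left of z and the upper bound right of z; monotonicity carries
    each across z. *)
Lemma id_stein_sol_bounds w : c - 1 <= m w <= c.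
Proof.
have Hl v : v <= z -> c - 1 <= m v.
  by move=> vz; rewrite /m stein_le//; have := mills_ub v; have := c1; nra.
have Hr v : z <= v -> m v <= c.
  by move=> vz; rewrite /m stein_ge//; have := mills_ub (- v); have := c0; nra.
have [wz|zw] := leP w z.
  rewrite Hl//= (le_trans (nondecreasing_id_stein_sol wz))//; exact: Hr.
rewrite (Hr _ (ltW zw)) andbT (le_trans _ (nondecreasing_id_stein_sol (ltW zw)))//.
exact: Hl.
Qed.

(** The Stein equation in integrated form. Away from z the slope is m + 1(. <= z) - c, with m
    nondecreasing and the indicator nonincreasing, so taking each term at the appropriate endpoint
    bounds the slope over the whole interval, even when it contains z. *)
Lemma stein_sol_incr u v : u <= v ->
  (v - u) * (m u + (v <= z)%R%:R - c) <= stein_sol v - stein_sol u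
  <= (v - u) * (m v + (u <= z)%R%:R - c).
Proof.
have slope a x b r : a <= x -> x <= b ->
    (b - a) * (m a + r - c) <= (m x + r - c) * (b - a) <= (b - a) * (m b + r - c).
  move=> ax xb.
  have m1 := nondecreasing_id_stein_sol ax; have m2 := nondecreasing_id_stein_sol xb.
  by rewrite mulrC -(mulrC (m b + _ - _)) !ler_wpM2r//; lra.
have H1 a b : a <= b -> b <= z ->
    (b - a) * (m a + 1 - c) <= stein_sol b - stein_sol a <= (b - a) * (m b + 1 - c).
  move=> ab bz; have az := le_trans ab bz; rewrite !stein_le//.
  have [|x /andP[ax xb] e] := MVT_le ab (_ : forall x, _ -> is_derive x 1
      (fun w => (1 - c) * mills w) ((1 - c) * (1 + x * mills x))).
    move=> x _; have d1 := is_derive_mills x.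
    by apply: is_derive_eq; rewrite /GRing.scale/=; ring.
  have mx : (1 - c) * (1 + x * mills x) = m x + 1 - c.
    by rewrite /m (stein_le (le_trans xb bz)); ring.
  rewrite e mx; exact: slope ax xb.
have H2 a b : a <= b -> z <= a ->
    (b - a) * (m a + 0 - c) <= stein_sol b - stein_sol a <= (b - a) * (m b + 0 - c).
  move=> ab za; have zb := le_trans za ab; rewrite !stein_ge//.
  have [|x /andP[ax xb] e] := MVT_le ab (_ : forall x, _ -> is_derive x 1
      (fun w => c * mills (- w)) (- c * (1 - x * mills (- x)))).
    move=> x _; have d1 := is_derive_mills (- x).
    have d2 : is_derive x 1 (mills \o -%R) (- (1 - x * mills (- x))).
      by apply: is_derive_eq; rewrite /GRing.scale/=; ring.
    by apply: is_derive_eq; rewrite /GRing.scale/=; ring.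
  have mx : - c * (1 - x * mills (- x)) = m x + 0 - c.
    by rewrite /m (stein_ge (le_trans za ax)); ring.
  rewrite e mx; exact: slope ax xb.
move=> uv; have [vz|zv] := leP v z.
  by rewrite (le_trans uv vz); exact: H1.
have [uz|zu] := leP u z; last first.
  by apply: H2 => //; exact: ltW.
have /andP[a1 a2] := H1 _ _ uz (lexx _).
have /andP[b1 b2] := H2 _ _ (ltW zv) (lexx _).
have m1 := nondecreasing_id_stein_sol uz; have m2 := nondecreasing_id_stein_sol (ltW zv).
have zu0 : 0 <= z - u by rewrite subr_ge0.
have vz0 : 0 <= v - z by rewrite subr_ge0 ltW.
have mzu : 0 <= (v - z) * (m z - m u) by rewrite mulr_ge0// subr_ge0.
have mvz : 0 <= (z - u) * (m v - m z) by rewrite mulr_ge0// subr_ge0.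
have -> : (nat_of_bool false)%:R = 0 :> R by [].
have -> : (nat_of_bool true)%:R = 1 :> R by [].
by apply/andP; split; lra.
Qed.

End normal_cdf.

(** * Concentration of W - xi_i *)

Lemma independent2_cstl d d1 d2 (T : measurableType d) (T1 : measurableType d1)
    (T2 : measurableType d2) (R : realType) (P : probability T R)
    (c : T1) (V : T -> T2) : independent2 P (fun=> c) V.
Proof.
move=> A B mA mB; have [cA|cA] := pselect (A c).
  rewrite (_ : _ @^-1` A = setT) ?setTI ?probability_setT ?mul1e//.
  by apply/seteqP; split.
rewrite (_ : _ @^-1` A = set0) ?set0I ?measure0 ?mul0e//.
by apply/seteqP; split.
Qed.

Lemma independent2C d d1 d2 (T : measurableType d) (T1 : measurableType d1)
    (T2 : measurableType d2) (R : realType) (P : probability T R)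
    (U : T -> T1) (V : T -> T2) : independent2 P U V -> independent2 P V U.
Proof. by move=> UV A B mA mB; rewrite setIC muleC; exact: UV. Qed.

Section truncated_moments.
Context {R : realFieldType}.
Implicit Types x delta : R.

(* min(delta, a) >= a - a^2 / (4 delta) *)
Lemma min_mul_ge x delta : 0 < delta ->
  x ^+ 2 * (`|x| <= 1)%R%:R - (4 * delta)^-1 * (`|x| ^+ 3 * (`|x| <= 1)%R%:R)
  <= `|x| * Num.min delta `|x|.
Proof.
move=> d0; have := normr_ge0 x; rewrite -[x ^+ 2]real_normK ?num_real//.
move: `|x| => y y0.
have [y1|_] := leP y 1; last by rewrite !mulr0 subr0 mulr_ge0// le_min y0 ltW.
rewrite !mulr1 (_ : _ - _ = y * (y - (4 * delta)^-1 * y ^+ 2)); last by ring.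
rewrite ler_wpM2l// le_min; apply/andP; split; last first.
  by rewrite gerBl mulr_ge0 ?sqr_ge0// invr_ge0 mulr_ge0// ltW.
rewrite -subr_ge0 (_ : _ - _ = (4 * delta)^-1 * (y - 2 * delta) ^+ 2).
  by rewrite mulr_ge0 ?sqr_ge0// invr_ge0 mulr_ge0// ltW.
by field; rewrite gt_eqF.
Qed.

(* max over y >= 0 of y^2 - y^3 / (4 delta), attained at y = 8 delta / 3 *)
Lemma sqr_sub_cube_le x delta : 0 < delta ->
  x ^+ 2 * (`|x| <= 1)%R%:R - (4 * delta)^-1 * (`|x| ^+ 3 * (`|x| <= 1)%R%:R)
  <= 64 / 27 * delta ^+ 2.
Proof.
move=> d0; have := normr_ge0 x; rewrite -[x ^+ 2]real_normK ?num_real//.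
move: `|x| => y y0.
have [y1|_] := leP y 1; last by rewrite !mulr0 subr0 mulr_ge0 ?sqr_ge0 ?divr_ge0.
rewrite !mulr1 -subr_ge0.
rewrite (_ : _ - _ = (4 * delta)^-1 * ((y - 8 / 3 * delta) ^+ 2 * (y + 4 / 3 * delta))).
  apply: mulr_ge0; first by rewrite invr_ge0 mulr_ge0// ltW.
  by rewrite mulr_ge0 ?sqr_ge0// addr_ge0// mulr_ge0// ?divr_ge0// ltW.
by field; rewrite gt_eqF.
Qed.

End truncated_moments.

Section fixed_interval.
Context {d} {T : measurableType d} {R : realType} (P : probability T R).
Variables (n : nat) (xi : 'I_n -> T -> R).
Hypothesis mxi : forall i, measurable_fun setT (xi i).
Hypothesis xi2 : forall i, integrableR P (fun w => xi i w ^+ 2).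
Hypothesis xi0 : forall i, Ex P (xi i) = 0.
Hypothesis xi_indep : forall i (Q : pred 'I_n), ~~ Q i ->
  independent2 P (xi i) (fun w => \sum_(k | Q k) xi k w).
Hypothesis xi_var : \sum_i Ex P (fun w => xi i w ^+ 2) = 1.

Lemma pairwise_independent i j : i != j -> independent2 P (xi i) (xi j).
Proof.
move=> ij; have := xi_indep (Q := pred1 j) ij.
by under eq_fun do rewrite big_pred1_eq.
Qed.

Definition sqr_small i w : R := xi i w ^+ 2 * (`|xi i w| <= 1)%R%:R.
Definition sqr_large i w : R := `|xi i w| ^+ 2 * (1 < `|xi i w|)%R%:R.
Definition cube_small i w : R := `|xi i w| ^+ 3 * (`|xi i w| <= 1)%R%:R.

Let mnxi i : measurable_fun setT (fun w => `|xi i w|).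
Proof. exact: measurableT_comp. Qed.

Let msmall i : measurable_fun setT (fun w => ((`|xi i w| <= 1)%R%:R : R)).
Proof.
have -> : (fun w => ((`|xi i w| <= 1)%R%:R : R)) = \1_[set w | `|xi i w| <= 1].
  by apply/funext => w; rewrite indicE mem_setE.
by apply: measurable_indic; exact: measurable_le_set.
Qed.

Let mlarge i : measurable_fun setT (fun w => ((1 < `|xi i w|)%R%:R : R)).
Proof.
have -> : (fun w => ((1 < `|xi i w|)%R%:R : R)) = fun w => 1 - (`|xi i w| <= 1)%R%:R.
  by apply/funext => w; rewrite ltNge; case: leP; rewrite ?subrr ?subr0.
exact: measurable_funB.
Qed.

Lemma sqr_split i w : xi i w ^+ 2 = sqr_small i w + sqr_large i w.
Proof.
rewrite /sqr_small /sqr_large real_normK ?num_real//.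
by case: ltP => _; rewrite ?mulr0 ?mulr1 ?addr0 ?add0r.
Qed.

Lemma integrable_sqr_small i : integrableR P (sqr_small i).
Proof.
rewrite ?/sqr_small ?/sqr_large; apply: (integrableR_le _ (xi2 i)).
  by apply: measurable_funM => //; exact: measurable_funX.
move=> w; rewrite normrM ler_piMr//.
by case: (`|xi i w| <= 1); rewrite ?normr0 ?normr1.
Qed.

Lemma integrable_sqr_large i : integrableR P (sqr_large i).
Proof.
rewrite ?/sqr_small ?/sqr_large; apply: (integrableR_le _ (xi2 i)).
  by apply: measurable_funM => //; exact: measurable_funX.
move=> w; rewrite real_normK ?num_real// normrM ler_piMr//.
by case: (1 < `|xi i w|); rewrite ?normr0 ?normr1.
Qed.

Lemma integrable_cube_small i : integrableR P (cube_small i).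
Proof.
rewrite /cube_small; apply: (@integrableR_bounded _ _ _ _ 1).
  by apply: measurable_funM => //; exact: measurable_funX.
move=> w; have [x1|_] := leP `|xi i w| 1; last by rewrite mulr0 normr0.
by rewrite mulr1 normrX normr_id exprn_ile1.
Qed.

Let a i := Ex P (sqr_small i).
Let b2 i := Ex P (sqr_large i).
Let b3 i := Ex P (cube_small i).

Lemma Ex_sqr_split i : Ex P (fun w => xi i w ^+ 2) = a i + b2 i.
Proof.
rewrite -ExD; [|exact: integrable_sqr_small|exact: integrable_sqr_large].
by congr (Ex P _); apply/funext => w; exact: sqr_split.
Qed.

Let eta delta i w : R := `|xi i w| * Num.min delta `|xi i w|.

Lemma integrable_eta delta i : 0 < delta -> integrableR P (eta delta i).
Proof.
move=> d0; apply: (integrableR_le _ (xi2 i)).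
  by apply: measurable_funM => //; exact: measurable_minr.
move=> w; rewrite normrM normr_id normrX expr2 ler_wpM2l//.
by rewrite ger0_norm ?ge_min ?lexx ?orbT// le_min normr_ge0 ltW.
Qed.

(** A minorant of [eta] whose expectation involves only truncated moments, and which is itself at
    most a constant times delta^2, so that dropping one index costs little. *)
Let cut delta i w : R := sqr_small i w - (4 * delta)^-1 * cube_small i w.

Let integrable_cut delta i : integrableR P (cut delta i).
Proof.
apply: integrableRB; first exact: integrable_sqr_small.
by apply: integrableRZ; exact: integrable_cube_small.
Qed.

Let Ex_cut delta i : Ex P (cut delta i) = a i - (4 * delta)^-1 * b3 i.
Proof.
rewrite ExB ?ExZ//.
- exact: integrable_cube_small.
- exact: integrable_sqr_small.
- by apply: integrableRZ; exact: integrable_cube_small.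
Qed.

Lemma Ex_eta_ge delta i : 0 < delta ->
  a i - (4 * delta)^-1 * b3 i <= Ex P (eta delta i).
Proof.
move=> d0; rewrite -Ex_cut; apply: Ex_le => //; first exact: integrable_eta.
by move=> w; exact: min_mul_ge.
Qed.

Let Ex_cut_le delta i : 0 < delta ->
  a i - (4 * delta)^-1 * b3 i <= 64 / 27 * delta ^+ 2.
Proof.
move=> d0; rewrite -Ex_cut -[leRHS](Ex_cst P); apply: Ex_le => //.
  exact: integrableR_cst.
by move=> w; exact: sqr_sub_cube_le.
Qed.

Definition trunc_beta := \sum_i b2 i + \sum_i b3 i.
Let beta := trunc_beta.

Let b2_ge0 i : 0 <= b2 i.
Proof. by apply: Ex_ge0 => w; rewrite mulr_ge0 ?exprn_ge0. Qed.

Let b3_ge0 i : 0 <= b3 i.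
Proof. by apply: Ex_ge0 => w; rewrite mulr_ge0 ?exprn_ge0. Qed.

Let sum_cut delta : \sum_j (a j - (4 * delta)^-1 * b3 j) =
  1 - \sum_j b2 j - (4 * delta)^-1 * \sum_j b3 j.
Proof.
rewrite sumrB -mulr_sumr -xi_var -sumrB; congr (_ - _).
by apply: eq_bigr => j _; rewrite Ex_sqr_split addrK.
Qed.

Lemma sum_Ex_eta_ge delta : 0 < delta ->
  1 - \sum_i b2 i - (4 * delta)^-1 * \sum_i b3 i <= \sum_i Ex P (eta delta i).
Proof.
move=> d0; rewrite -sum_cut.
by apply: ler_sum => i _; exact: Ex_eta_ge.
Qed.

(** If beta were 0, the expectations of the [cut delta j] would add up to the full variance 1 for
    every delta, although each is at most 64/27 delta^2. *)
Lemma trunc_beta_gt0 : 0 < beta.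
Proof.
have s3 : 0 <= \sum_i b3 i by exact: sumr_ge0.
have s2 : 0 <= \sum_i b2 i by exact: sumr_ge0.
rewrite lt_neqAle addr_ge0// andbT; apply/eqP => b0.
have b30 : \sum_i b3 i = 0 by move: b0; rewrite /beta /trunc_beta -/(b2 _); lra.
have b20 : \sum_i b2 i = 0 by move: b0; rewrite /beta /trunc_beta; lra.
(* Since (n + 2)^2 >= 8 n, the n terms add up to at most 8/27 < 1. *)
pose delta : R := (n%:R + 2)^-1.
have n2 : 0 < n%:R + 2 :> R by rewrite ltr_wpDl.
have d0 : 0 < delta by rewrite invr_gt0.
have := sum_cut delta; rewrite b20 b30 mulr0 !subr0 => tot.
have : \sum_j (a j - (4 * delta)^-1 * b3 j) <= \sum_(j < n) 64 / 27 * delta ^+ 2.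
  by apply: ler_sum => j _; exact: Ex_cut_le.
rewrite tot sumr_const card_ord -[_ *+ n]mulr_natl leNgt => /negP; apply.
rewrite /delta exprVn mulrA ltr_pdivrMr ?exprn_gt0// mul1r.
by have := sqr_ge0 (n%:R - 2 : R); nra.
Qed.

(** With 4 delta = 2 beta, the deficit times 2 beta is 2 beta sum b2 + sum b3 <= beta because 2 beta
    <= 1; hence the deficit is at most 1/2. *)
Lemma sum_Ex_eta_half : 0 < beta < 2^-1 ->
  2^-1 <= \sum_i Ex P (eta (beta / 2) i).
Proof.
move=> /andP[b0 b12]; apply: le_trans (sum_Ex_eta_ge _); last by rewrite divr_gt0.
have -> : 4 * (beta / 2) = 2 * beta by field.
have s3 : 0 <= \sum_i b3 i by exact: sumr_ge0.
have s2 : 0 <= \sum_i b2 i by exact: sumr_ge0.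
have e : beta = \sum_i b2 i + \sum_i b3 i by [].
rewrite -(@ler_pM2l _ (2 * beta)) ?mulr_gt0//.
rewrite mulrBr mulrA mulfV ?mul1r; last by rewrite gt_eqF ?mulr_gt0.
move: e; move: (\sum_i b2 i) (\sum_i b3 i) s2 s3 => x y x0 y0 e.
have : 0 <= (1 - 2 * beta) * x by rewrite mulr_ge0//; lra.
rewrite e; lra.
Qed.

(** With 4 delta = 28/10 beta the deficit is at most 10/28, and the missing index costs at most
    64/27 (7/41)^2 < 0.07; together they stay below 1/2. *)
Lemma sum_Ex_eta_half_but i : 0 < beta <= 10 / 41 ->
  2^-1 <= \sum_(j | j != i) Ex P (eta (7 / 10 * beta) j).
Proof.
move=> /andP[b0 b1]; set delta := 7 / 10 * beta.
have d0 : 0 < delta by rewrite mulr_gt0.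
apply: (@le_trans _ _ (\sum_(j | j != i) (a j - (4 * delta)^-1 * b3 j))); last first.
  by apply: ler_sum => j _; exact: Ex_eta_ge.
have tot := sum_cut delta.
move: tot; rewrite (bigD1 i)//= => tot.
have := Ex_cut_le i d0.
have s3 : 0 <= \sum_i b3 i by exact: sumr_ge0.
have s2 : 0 <= \sum_i b2 i by exact: sumr_ge0.
have e : beta = \sum_i b2 i + \sum_i b3 i by [].
have h : \sum_j b2 j + (4 * delta)^-1 * \sum_j b3 j <= 10 / 28.
  rewrite -(@ler_pM2l _ (4 * delta)) ?mulr_gt0// mulrDr [X in _ + X]mulrA mulfV ?mul1r; last first.
    by rewrite gt_eqF ?mulr_gt0.
  rewrite /delta.
  move: e; move: (\sum_i b2 i) (\sum_i b3 i) s2 s3 => x y x0 y0 e.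
  have : 0 <= (1 - 28 / 10 * beta) * x by rewrite mulr_ge0//; lra.
  rewrite e; lra.
have d2 : delta ^+ 2 <= (7 / 41) ^+ 2.
  rewrite lerXn2r ?nnegrE ?divr_ge0 ?(ltW d0)//.
  by rewrite /delta; lra.
move: tot h d2; move: (\sum_(j | _) _) (\sum_i b2 i) (_ * \sum_i b3 i) (a i - _).
move: (delta ^+ 2) => u v x y t; lra.
Qed.

Section zeroed.
Variable Q : pred 'I_n.

(** Keeps a partial sum in the form of a sum over all of ['I_n], as [concentration] expects. *)
Definition zeroed j w := if Q j then xi j w else 0.

Let zeroedE j : zeroed j = if Q j then xi j else (fun=> 0).
Proof. by apply/funext => w; rewrite /zeroed; case: (Q j). Qed.

Lemma sum_zeroed w (S : pred 'I_n) :
  \sum_(k | S k) zeroed k w = \sum_(k | S k && Q k) xi k w.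
Proof. by rewrite big_mkcondr. Qed.

Lemma measurable_zeroed j : measurable_fun setT (zeroed j).
Proof. by rewrite zeroedE; case: (Q j). Qed.

Lemma integrable_sqr_zeroed j : integrableR P (fun w => zeroed j w ^+ 2).
Proof.
rewrite /zeroed; case: (Q j) => //; rewrite expr0n; exact: integrableR_cst.
Qed.

Lemma Ex_zeroed j : Ex P (zeroed j) = 0.
Proof. by rewrite zeroedE; case: (Q j) => //; rewrite Ex_cst. Qed.

Lemma independent_zeroed j k : j != k -> independent2 P (zeroed j) (zeroed k).
Proof.
move=> jk; rewrite !zeroedE; case: (Q j); last exact: independent2_cstl.
case: (Q k); last exact/independent2C/independent2_cstl.
exact: pairwise_independent.
Qed.

Lemma var_zeroed : \sum_j Ex P (fun w => zeroed j w ^+ 2) <= 1.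
Proof.
rewrite -xi_var; apply: ler_sum => j _; rewrite /zeroed; case: (Q j) => //.
by rewrite expr0n Ex_cst Ex_ge0// => w; exact: sqr_ge0.
Qed.

Lemma Ex_norm_sum_zeroed_le1 :
  integrableR P (fun w => \sum_j zeroed j w) /\
  Ex P (fun w => `|\sum_j zeroed j w|) <= 1.
Proof.
have [S2 ES2] := Ex_sqr_sum measurable_zeroed integrable_sqr_zeroed Ex_zeroed
  independent_zeroed.
have Si : integrableR P (fun w => \sum_j zeroed j w).
  by apply: integrableR_sqr => //; apply: measurable_sum => j; exact: measurable_zeroed.
split => //; apply: (@le_trans _ _ (Ex P (fun w => 2^-1 + 2^-1 * (\sum_j zeroed j w) ^+ 2))).
  apply: Ex_le; first exact: integrableR_norm.
    by apply: integrableRD; [exact: integrableR_cst|exact: integrableRZ].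
  move=> w; rewrite -[(\sum_j _) ^+ 2]real_normK ?num_real//.
  by have := sqr_ge0 (`|\sum_j zeroed j w| - 1); nra.
rewrite ExD ?ExZ ?Ex_cst ?ES2//; [|exact: integrableR_cst|exact: integrableRZ].
by have := var_zeroed; lra.
Qed.

End zeroed.

(** With D and all D_i equal to the constant l, the terms D - D_i vanish, and E|V l| <= l since V
    has variance at most 1. *)
Lemma concentration_but i z l : 0 < beta <= 10 / 41 -> 0 <= l ->
  Ex P \1_[set w | z <= \sum_(k | k != i) xi k w <= z + l] <= 21 / 10 * beta + l.
Proof.
move=> /[dup] bb /andP[b0 b1] l0.
pose N := zeroed (fun j => j != i).
have Nind j : independent2 P (N j) (fun w => (l, \sum_k N k w - N j w)).
  have [ji|ji] := eqVneq j i.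
    rewrite (_ : N j = fun=> 0); first exact: independent2_cstl.
    by apply/funext => w; rewrite /N /zeroed ji eqxx.
  have -> : (fun w => (l, \sum_k N k w - N j w)) =
      (fun x => (l, x)) \o (fun w => \sum_(k | (k != j) && (k != i)) xi k w).
    apply/funext => w /=; congr (_, _).
    by rewrite (bigD1 j)//= addrC addrK sum_zeroed.
  have -> : N j = xi j by apply/funext => w; rewrite /N /zeroed ji.
  apply: (independent2_comp (@measurable_id _ _ setT)).
    exact/measurable_fun_pair.
  by apply: xi_indep; rewrite eqxx.
have Neta : 2^-1 <= \sum_j Ex P (fun w => `|N j w| * Num.min (7 / 10 * beta) `|N j w|).
  apply: le_trans (sum_Ex_eta_half_but i bb) _.
  rewrite [leLHS]big_mkcond/=; apply: ler_sum => j _; rewrite /N /zeroed.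
  case: eqP => //= _; apply: Ex_ge0 => w; rewrite normr0 mul0r//.
have d0 : 0 < 7 / 10 * beta by rewrite mulr_gt0.
have ll : 0 <= l <= l by rewrite l0 lexx.
have := concentration (measurable_zeroed _) (integrable_sqr_zeroed _) (Ex_zeroed _)
  (@independent_zeroed _) (var_zeroed _) d0 z (@measurable_cst _ _ _ _ setT l)
  (fun=> @measurable_cst _ _ _ _ setT l) (fun=> ll) (fun _ _ => ll) Nind Neta.
have -> : [set w | z <= \sum_(k | k != i) xi k w <= z + l] =
    [set w | z <= \sum_k N k w <= z + l].
  by apply/seteqP; split => w; rewrite /= sum_zeroed.
move=> /le_trans; apply; rewrite [X in _ + X <= _]big1 ?addr0; last first.
  by move=> j _; rewrite -[RHS](Ex_cst P); congr (Ex P _);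
    apply/funext => w; rewrite subrr mulr0 normr0.
have [Wi EW] := Ex_norm_sum_zeroed_le1 (fun j => j != i).
apply: lerD; first by lra.
have -> : (fun w => `|(\sum_j N j w) * l|) = (fun w => l * `|\sum_j N j w|).
  by apply/funext => w; rewrite normrM mulrC ger0_norm.
rewrite ExZ; last exact: integrableR_norm.
by rewrite ler_piMr.
Qed.

End fixed_interval.

(** * Increments of the Stein solution *)

Section slope_bounds.
Context {R : realType}.
Implicit Types (f M H : R -> R) (a b c q : R).

(* The increments of f are estimated on a uniform partition; the error
   telescopes to (b - a) / N * (M b - M a). *)
Lemma increment_le f M H c a b q : a <= b ->
  (forall u v, u <= v -> f v - f u <= (v - u) * (M v + H u - c)) ->
  (forall t, a <= t <= b -> M t + H t - c <= q) ->
  f b - f a <= (b - a) * q.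
Proof.
move=> ab fMH Mq; apply/ler_addgt0Pr => e e0.
pose C := `|(b - a) * (M b - M a)|.
pose N := (Num.bound (C / e)).+1.
have N0 : 0 < N%:R :> R by rewrite ltr0n.
pose h := (b - a) / N%:R.
have h0 : 0 <= h by rewrite divr_ge0 ?subr_ge0// ltW.
pose t k := a + k%:R * h.
have t0 : t 0%N = a by rewrite /t mul0r addr0.
have tN : t N = b by rewrite /t /h; field; rewrite gt_eqF.
have tS k : t k.+1 - t k = h by rewrite /t -natr1; ring.
have tab k : (k < N)%N -> a <= t k <= b.
  move=> kN; rewrite /t lerDl mulr_ge0//= -lerBrDl /h mulrCA ler_piMr ?subr_ge0//.
  by rewrite ler_pdivrMr// mul1r ler_nat ltnW.
have : f b - f a <= \sum_(0 <= k < N) (h * q + h * (M (t k.+1) - M (t k))).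
  rewrite -tN -t0 -(telescope_sumr (fun k => f (t k)))//.
  rewrite big_nat [leRHS]big_nat; apply: ler_sum => k /= kN.
  have tk : t k <= t k.+1 by rewrite -subr_ge0 tS.
  apply: (le_trans (fMH _ _ tk)); rewrite tS -mulrDr ler_wpM2l//.
  by have := Mq _ (tab _ kN); lra.
rewrite big_split/= sumr_const_nat subn0 -mulr_sumr telescope_sumr// tN t0.
move=> /le_trans; apply; apply: lerD.
  by rewrite -mulr_natl /h mulrA mulrCA mulfV ?mulr1 ?gt_eqF.
rewrite /h mulrAC ler_pdivrMr//; apply: (le_trans (ler_norm _)); rewrite -/C.
rewrite -ler_pdivrMl// mulrC; apply: (@le_trans _ _ (Num.bound (C / e))%:R).
  by apply/ltW/archi_boundP; rewrite divr_ge0 ?normr_ge0 ?(ltW e0).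
by rewrite ler_nat.
Qed.

Variables (f M H : R -> R) (c : R).
Hypothesis f_incr : forall u v, u <= v ->
  (v - u) * (M u + H v - c) <= f v - f u <= (v - u) * (M v + H u - c).
Variable B : R -> R.
Hypothesis B_incr : forall u v, u <= v -> B u <= B v.
Hypothesis MB : forall u v, u <= v -> 0 <= M v - M u <= B (v - u).
Hypothesis HB : forall u v, u <= v -> 0 <= H u - H v <= B (v - u).

Let p t := M t + H t - c.

(* M increases and H decreases, so only one of them contributes to each sign. *)
Let p_osc x t : `|p x - p t| <= B `|x - t|.
Proof.
wlog tx : x t / t <= x.
  move=> wl; have [tx|xt] := leP t x; first exact: wl.
  by rewrite distrC (distrC x); apply/wl/ltW.
have /andP[h1 h2] := MB tx; have /andP[h3 h4] := HB tx.
by rewrite [in leRHS]ger0_norm ?subr_ge0// ler_norml /p; lra.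
Qed.

(** Morally f(y) - f(0) is the integral of p over [0, y], so the left side averages p x - p t over t
    between 0 and y, where |x - t| <= |x| + |y|. *)
Lemma increment_dist x y :
  `|y * p x - (f y - f 0)| <= `|y| * B (`|x| + `|y|).
Proof.
have osc t : `|t| <= `|y| -> `|p x - p t| <= B (`|x| + `|y|).
  move=> ty; apply: (le_trans (p_osc _ _)); apply: B_incr.
  by apply: (le_trans (ler_normB _ _)); rewrite lerD2l.
have main a b : a <= b -> (forall t, a <= t <= b -> `|t| <= `|y|) ->
    `|(b - a) * p x - (f b - f a)| <= (b - a) * B (`|x| + `|y|).
  move=> ab abt; set D := B _ in osc *.
  have up : f b - f a <= (b - a) * (p x + D).
    apply: (@increment_le f M H c) => // [u v uv|t tab].
      by have /andP[] := f_incr uv.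
    by have := osc _ (abt _ tab); rewrite ler_norml /p; lra.
  (* Negation exchanges the roles: - f has nondecreasing part - H and nonincreasing part - M. *)
  have lo : - f b - - f a <= (b - a) * (D - p x).
    apply: (@increment_le (fun x => - f x) (fun x => - H x) (fun x => - M x) (- c)) => //.
      by move=> u v uv; have /andP[+ _] := f_incr uv; lra.
    by move=> t tab; have := osc _ (abt _ tab); rewrite ler_norml /p; lra.
  by rewrite ler_norml; apply/andP; split; lra.
have [y0|y0] := leP 0 y.
  have := main _ _ y0; rewrite subr0 (ger0_norm y0); apply => t /andP[t0 ty].
  by rewrite ger0_norm.
have := main _ _ (ltW y0); rewrite sub0r (ltr0_norm y0) => h.
have -> : y * p x - (f y - f 0) = - (- y * p x - (f 0 - f y)) by ring.
rewrite normrN; apply: h => t /andP[yt t0].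
by rewrite ler0_norm// lerN2.
Qed.

End slope_bounds.

(** * From intervals to bounded monotone functions *)

Section monotone_layer_cake.
Context {d} {T : measurableType d} {R : realType} (P : probability T R).
Variables (V : T -> R) (m : R -> R) (kappa c : R).
Hypothesis mV : measurable_fun setT V.
Hypothesis m_nd : {homo m : u v / u <= v}.
Hypothesis m_bnd : forall w, c - 1 <= m w <= c.
Hypothesis conc : forall z l, 0 <= l ->
  Ex P \1_[set w | z <= V w <= z + l] <= kappa + l.

Let m0 w := m w - (c - 1).

Let m0_ge0 w : 0 <= m0 w. Proof. by have := m_bnd w; rewrite /m0; lra. Qed.
Let m0_le1 w : m0 w <= 1. Proof. by have := m_bnd w; rewrite /m0; lra. Qed.

Let mm : measurable_fun [set: R] m.
Proof. exact: nondecreasing_measurable. Qed.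

Let mmV u : measurable_fun setT (fun w => m (V w + u)).
Proof. by apply: measurableT_comp => //; exact: measurable_funD. Qed.

Lemma integrable_shift u : integrableR P (fun w => m (V w + u)).
Proof.
apply: (@integrableR_bounded _ _ _ _ (`|c - 1| + `|c|)) => // w.
have := m_bnd (V w + u); have := ler_norm c; have := ler_norm (- (c - 1)).
rewrite normrN ler_norml; have := normr_ge0 c; have := normr_ge0 (c - 1); lra.
Qed.

Let mY u : measurable_fun setT (fun w => m0 (V w + u)).
Proof. exact: measurable_funB. Qed.

Let Y u : {mfun T >-> R} := mfun_Sub (mem_set (mY u)).

(* {m0 (V + v) > r >= m0 (V + u)} confines V to an interval of length v - u,
   because {m0 > r} is a ray. *)
Let ccdf_le u v r : u <= v ->
  (ccdf (P := P) (Y v) r <= ccdf (P := P) (Y u) r + (kappa + (v - u))%:E)%E.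
Proof.
move=> uv.
have m0_nd x y : x <= y -> m0 x <= m0 y by move=> xy; rewrite lerD2r; exact: m_nd.
pose A u := [set w | r < m0 (V w + u)].
have mA x : measurable (A x).
  have -> : A x = ~` [set w | m0 (V w + x) <= r].
    by apply/seteqP; split => w; rewrite /A/= ltNge => /negP.
  by apply: measurableC; exact: measurable_le_set.
have ccdfE x : ccdf (P := P) (Y x) r = P (A x).
  by rewrite /ccdf /distribution /pushforward; congr (P _); apply/seteqP; split => w;
    rewrite /preimage /A /= in_itv/= andbT.
rewrite !ccdfE.
pose U := [set s | r < m0 s].
(* [inf U] is the endpoint of the ray only if U is nonempty and bounded below. Otherwise [A v] is
   empty or [A u] is everything. *)
have [[s0 Us0]|U0] := pselect (U !=set0); last first.
  rewrite (_ : A v = set0) ?measure0; last first.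
    by apply/seteqP; split => w //= Aw; apply: U0; exists (V w + v).
  apply: adde_ge0 => //; rewrite lee_fin.
  apply: (le_trans _ (@conc 0 (v - u) _)); last by rewrite subr_ge0.
  by apply: Ex_ge0 => w; rewrite indicE.
have [lbU|nlb] := pselect (has_lbound U); last first.
  have UT s : U s.
    apply: contrapT => nUs; apply: nlb; exists s => t Ut; rewrite leNgt.
    apply/negP => ts; apply: nUs; exact: lt_le_trans (m0_nd _ _ (ltW ts)).
  rewrite (_ : A u = setT); last by apply/seteqP; split => w //= _; exact: UT.
  rewrite probability_setT (le_trans (probability_le1 _ _))// leeDl// lee_fin.
  apply: (le_trans _ (@conc 0 (v - u) _)); last by rewrite subr_ge0.
  by apply: Ex_ge0 => w; rewrite indicE.
have vu0 : 0 <= v - u by rewrite subr_ge0.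
pose z := inf U - v.
have mI : measurable [set w | z <= V w <= z + (v - u)].
  by apply: measurable_between.
apply: (@le_trans _ _ (P (A u `|` [set w | z <= V w <= z + (v - u)]))).
  apply: le_measure; rewrite ?inE//; first exact: measurableU.
  move=> w Avw; have [Auw|nA] := pselect (A u w); [by left|right].
  have h1 : inf U <= V w + v by apply: ge_inf.
  have h2 : V w + u <= inf U.
    apply: lb_le_inf; first by exists s0.
    move=> t Ut; rewrite leNgt; apply/negP => tV; apply: nA.
    exact: lt_le_trans (m0_nd _ _ (ltW tV)).
  by rewrite /= /z; lra.
apply: (le_trans (measureU2 _ (mA u) mI)); rewrite leeD2l//.
by have := @conc z _ vu0; rewrite -lee_fin Ex_indic.
Qed.

(** Layer cake: each expectation is the integral of its tail over r >= 0, the tails vanish for r >=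
    1 because m ranges in an interval of length 1, and on [0, 1] they differ by at most kappa + (v -
    u). *)
Lemma Ex_shift_incr u v : u <= v ->
  Ex P (fun w => m (V w + v)) - Ex P (fun w => m (V w + u)) <= kappa + (v - u).
Proof.
move=> uv; have q0 : 0 <= kappa + (v - u).
  apply: (le_trans _ (@conc 0 (v - u) _)); last by rewrite subr_ge0.
  by apply: Ex_ge0 => w; rewrite indicE.
have YE x : ('E_P[Y x])%E = (Ex P (fun w => m (V w + x)) - (c - 1))%:E.
  rewrite unlock/= Ex_EFin; last first.
    by apply: integrableRB; [exact: integrable_shift|exact: integrableR_cst].
  by rewrite ExB ?Ex_cst//; [exact: integrable_shift|exact: integrableR_cst].
have ccdf0 r : 1 <= r -> ccdf (P := P) (Y v) r = 0%E.
  move=> r1; rewrite /ccdf /distribution /pushforward (_ : _ @^-1` _ = set0) ?measure0//.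
  apply/seteqP; split => w //; rewrite /preimage/= in_itv/= andbT => rY.
  by have := m0_le1 (V w + v); lra.
have : ('E_P[Y v] <= 'E_P[Y u] + (kappa + (v - u))%:E)%E.
  rewrite !ge0_expectation_ccdf; [|by move=> w; exact: m0_ge0..].
  have -> : (kappa + (v - u))%:E = (\int[lebesgue_measure]_(r in `[0%R, +oo[)
      ((kappa + (v - u)) * \1_`[0%R, 1%R] r)%:E)%E.
    under eq_integral do rewrite EFinM.
    rewrite ge0_integralZl//=; last first.
    - by apply/measurable_EFinP; exact: measurable_indic.
    rewrite integral_indic//= setIidl; last first.
      by move=> r /=; rewrite !in_itv/= => /andP[->].
    by rewrite lebesgue_measure_itv/= lte01 sube0 mule1.
  have mq : measurable_fun (`[0%R, +oo[%classic : set (measurableTypeR R))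
      (fun r : measurableTypeR R => ((kappa + (v - u)) * \1_`[0%R, 1%R] r)%:E).
    by apply/measurable_EFinP/measurable_funM => //; exact: measurable_indic.
  have mc x : measurable_fun (`[0%R, +oo[%classic : set (measurableTypeR R)) (ccdf (P := P) (Y x)).
    by apply: measurable_funTS; exact: ccdf_measurable.
  have q1 r : (0 <= ((kappa + (v - u)) * \1_`[0%R, 1%R] r)%:E)%E.
    by rewrite lee_fin mulr_ge0// indicE.
  rewrite -ge0_integralD//.
  apply: ge0_le_integral => //.
  - by apply: emeasurable_funD => //; exact: mc.
  - move=> r /=; rewrite in_itv/= andbT => r0; rewrite indicE.
    have [r1|r1] := leP r 1.
      by rewrite mem_set ?mulr1 ?ccdf_le//= in_itv/= r0.
    rewrite ccdf0 ?(ltW r1)// memNset ?mulr0 ?adde0//=.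
    by rewrite in_itv/= r0/= => /(lt_le_trans r1); rewrite ltxx.
rewrite !YE -EFinD lee_fin; lra.
Qed.

End monotone_layer_cake.

(** * Normal approximation of W *)

Section berry_esseen.
Context {d} {T : measurableType d} {R : realType} (P : probability T R).
Variables (n : nat) (xi : 'I_n -> T -> R).
Hypothesis mxi : forall i, measurable_fun setT (xi i).
Hypothesis xi2 : forall i, integrableR P (fun w => xi i w ^+ 2).
Hypothesis xi0 : forall i, Ex P (xi i) = 0.
Hypothesis xi_indep : forall i (Q : pred 'I_n), ~~ Q i ->
  independent2 P (xi i) (fun w => \sum_(k | Q k) xi k w).
Hypothesis xi_var : \sum_i Ex P (fun w => xi i w ^+ 2) = 1.
Let beta := trunc_beta P xi.
Hypothesis beta_bnd : 0 < beta <= 10 / 41.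

Let a i := Ex P (sqr_small xi i).
Let b2 i := Ex P (sqr_large xi i).
Let b3 i := Ex P (cube_small xi i).

Let xii i : integrableR P (xi i).
Proof. exact: integrableR_sqr. Qed.

Let Y i w : R := Num.min 1 `|xi i w|.

Let mY i : measurable_fun setT (Y i).
Proof. by apply: measurable_minr => //; exact: measurableT_comp. Qed.

Let Y01 i w : 0 <= Y i w <= 1.
Proof. by rewrite /Y le_min ler01 normr_ge0 ge_min lexx. Qed.

Let YX_int k i : integrableR P (fun w => Y i w ^+ k).
Proof.
apply: (@integrableR_bounded _ _ _ _ 1); first exact: measurable_funX.
by move=> w; have /andP[y0 y1] := Y01 i w; rewrite normrX ger0_norm// exprn_ile1.
Qed.

Let e i := Ex P (Y i).

(* Chebyshev's association inequality E[Y^2] E[Y] <= E[Y^3] for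
   Y = min(1, |xi_i|), from (Y^2 - e^2)(Y - e) >= 0 with e = E[Y]. *)
Let Ex_min_sqr_small i : e i * a i <= b2 i + b3 i.
Proof.
have Yi : integrableR P (Y i) by have := YX_int 1 i.
have e0 : 0 <= e i by apply: Ex_ge0 => w; have /andP[] := Y01 i w.
have aY : a i <= Ex P (fun w => Y i w ^+ 2).
  apply: Ex_le => //; first exact: integrable_sqr_small.
  move=> w; rewrite /sqr_small /Y -[xi i w ^+ 2]real_normK ?num_real//.
  by have [x1|x1] := leP `|xi i w| 1; rewrite ?mulr1 ?mulr0 ?sqr_ge0// ?min_r.
have Y3 : Ex P (fun w => Y i w ^+ 3) <= b2 i + b3 i.
  rewrite -ExD; [|exact: integrable_sqr_large|exact: integrable_cube_small].
  apply: Ex_le => //.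
    by apply: integrableRD; [exact: integrable_sqr_large|exact: integrable_cube_small].
  move=> w; rewrite /sqr_large /cube_small /Y.
  have [x1|x1] := leP `|xi i w| 1; first by rewrite mulr0 mulr1 add0r.
  rewrite mulr1 mulr0 addr0 expr1n.
  by rewrite expr_ge1// ltW.
have assoc : 0 <= Ex P (fun w => Y i w ^+ 3 - e i * Y i w ^+ 2 - (e i ^+ 2 * Y i w - e i ^+ 3)).
  apply: Ex_ge0 => w; have /andP[y0 y1] := Y01 i w.
  rewrite (_ : _ - _ = (Y i w + e i) * (Y i w - e i) ^+ 2); last by ring.
  by rewrite mulr_ge0 ?sqr_ge0// addr_ge0.
have i1 : integrableR P (fun w => e i * Y i w ^+ 2) by exact: integrableRZ.
have i2 : integrableR P (fun w => e i ^+ 2 * Y i w) by exact: integrableRZ.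
have i3 := integrableR_cst P (e i ^+ 3).
move: assoc; rewrite (ExB (integrableRB (YX_int 3 i) i1) (integrableRB i2 i3)).
rewrite (ExB (YX_int 3 i) i1) (ExB i2 i3) Ex_cst (ExZ _ (YX_int 2 i)) (ExZ _ Yi) -/(e i).
have := ler_wpM2l e0 aY; lra.
Qed.

Variable z : R.
Let c := ncdf z.
Let f := stein_sol z.
Let m w := w * f w.
Let h w : R := (w <= z)%R%:R.
Let kappa := 21 / 10 * beta.
Let W w := \sum_k xi k w.
Let V i w := \sum_(k | k != i) xi k w.

Let WE i w : W w = V i w + xi i w.
Proof. by rewrite /W (bigD1 i)//= addrC. Qed.

Let mV i : measurable_fun setT (V i).
Proof.
have -> : V i = fun w => \sum_(k <- [seq k <- index_enum 'I_n | k != i]) xi k w.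
  by apply/funext => w; rewrite big_filter.
exact: measurable_sum.
Qed.

Let mVu i u : measurable_fun setT (fun w => V i w + u).
Proof. exact: measurable_funD. Qed.

Let mf : measurable_fun [set: R] f. Proof. exact: measurable_stein_sol. Qed.

Let m_nd : {homo m : u v / u <= v}. Proof. exact: nondecreasing_id_stein_sol. Qed.

Let m_bnd w : c - 1 <= m w <= c. Proof. exact: id_stein_sol_bounds. Qed.

Let mm : measurable_fun [set: R] m. Proof. exact: nondecreasing_measurable. Qed.

Let mh : measurable_fun [set: R] h.
Proof.
have -> : h = \1_[set w | w <= z] by apply/funext => w; rewrite indicE mem_setE.
by apply: measurable_indic; exact: measurable_le_set.
Qed.

Let h01 w : 0 <= h w <= 1.
Proof. by rewrite /h; case: (w <= z); rewrite ?lexx ?ler01. Qed.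

Let conc i x l : 0 <= l ->
  Ex P \1_[set w | x <= V i w <= x + l] <= kappa + l.
Proof. exact: concentration_but. Qed.

Let integrable_f (u : T -> R) : measurable_fun setT u -> integrableR P (fun w => f (u w)).
Proof.
move=> mu; apply: (@integrableR_bounded _ _ _ _ (mills z + mills (- z))).
  exact: measurableT_comp.
by move=> w; exact: stein_sol_norm_le.
Qed.

Let integrable_m (u : T -> R) : measurable_fun setT u -> integrableR P (fun w => m (u w)).
Proof.
move=> mu; apply: (@integrableR_bounded _ _ _ _ (`|c - 1| + `|c|)).
  exact: measurableT_comp.
move=> w; have := m_bnd (u w); have := ler_norm c; have := ler_norm (- (c - 1)).
rewrite normrN ler_norml; have := normr_ge0 c; have := normr_ge0 (c - 1); lra.
Qed.

Let integrable_h (u : T -> R) : measurable_fun setT u -> integrableR P (fun w => h (u w)).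
Proof.
move=> mu; apply: (@integrableR_bounded _ _ _ _ 1); first exact: measurableT_comp.
by move=> w; have /andP[h0 h1] := h01 (u w); rewrite ger0_norm.
Qed.

Let F i v := Ex P (fun w => f (V i w + v)).
Let M i v := Ex P (fun w => m (V i w + v)).
Let H i v := Ex P (fun w => h (V i w + v)).
(** The cap 1 holds because m and h each range in an interval of length 1; it keeps large |xi_i|
    from producing third moments, which may be infinite. *)
Let B l := Num.min 1 (kappa + l).

Let F_incr i u v : u <= v ->
  (v - u) * (M i u + H i v - c) <= F i v - F i u <= (v - u) * (M i v + H i u - c).
Proof.
move=> uv; have ifu x := integrable_f (mVu i x).
have imu x := integrable_m (mVu i x); have ihu x := integrable_h (mVu i x).
have ic := integrableR_cst P c.
have imh x y := integrableRD (imu x) (ihu y).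
have FE : F i v - F i u = Ex P (fun w => f (V i w + v) - f (V i w + u)).
  by rewrite (ExB (ifu v) (ifu u)).
have MHE x y : M i x + H i y - c = Ex P (fun w => m (V i w + x) + h (V i w + y) - c).
  by rewrite (ExB (imh x y) ic) (ExD (imu x) (ihu y)) Ex_cst.
rewrite FE !MHE.
have pw w := @stein_sol_incr R z (V i w + u) (V i w + v) (lerD (lexx _) uv).
have vuE w : v - u = V i w + v - (V i w + u) by ring.
apply/andP; split; rewrite -(ExZ _ (integrableRB (imh _ _) ic)); apply: Ex_le => [||w].
- exact/integrableRZ/integrableRB.
- exact: integrableRB.
- by rewrite [X in X * _](vuE w); have /andP[] := pw w.
- exact: integrableRB.
- exact/integrableRZ/integrableRB.
- by rewrite [X in X * _](vuE w); have /andP[] := pw w.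
Qed.

Let B_incr u v : u <= v -> B u <= B v.
Proof.
by move=> uv; rewrite /B le_min !ge_min lexx/= lerD2l uv orbT.
Qed.

Let M_incr i u v : u <= v -> 0 <= M i v - M i u <= B (v - u).
Proof.
move=> uv; have imu x := integrable_m (mVu i x).
rewrite subr_ge0 Ex_le//=; last by move=> w; apply: m_nd; rewrite lerD2l.
rewrite le_min; apply/andP; split.
  rewrite -(ExB (imu v) (imu u)) -[leRHS](Ex_cst P); apply: Ex_le.
  - exact: integrableRB.
  - exact: integrableR_cst.
  - by move=> w; have := m_bnd (V i w + v); have := m_bnd (V i w + u); lra.
exact: (Ex_shift_incr (mV i) m_nd m_bnd (conc i) uv).
Qed.

Let H_incr i u v : u <= v -> 0 <= H i u - H i v <= B (v - u).
Proof.
move=> uv; have ihu x := integrable_h (mVu i x).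
have vu0 : 0 <= v - u by rewrite subr_ge0.
have h_le x y : x <= y -> h y <= h x.
  move=> xy; rewrite /h; have [yz|_] := leP y z; last by rewrite ler0n.
  by rewrite (le_trans xy yz).
rewrite subr_ge0 Ex_le//=; last by move=> w; apply: h_le; rewrite lerD2l.
rewrite -(ExB (ihu u) (ihu v)) le_min; apply/andP; split.
  rewrite -[leRHS](Ex_cst P); apply: Ex_le.
  - exact: integrableRB.
  - exact: integrableR_cst.
  - by move=> w; have := h01 (V i w + v); have := h01 (V i w + u); lra.
apply: le_trans (conc i (z - v) vu0); apply: Ex_le.
- exact: integrableRB.
- by apply: integrableR_indic; exact: measurable_between.
move=> w; rewrite indicE /h; have [vz|vz] := leP (V i w + v) z.
  by rewrite (le_trans _ vz) ?lerD2l// subrr.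
have [uz|uz] := leP (V i w + u) z; last by rewrite subrr.
by rewrite subr0 mem_set//=; lra.
Qed.

(** Plays the part of E f'(W), written through the Stein equation. *)
Let q := Ex P (fun w => m (W w) + h (W w) - c).

Let mW : measurable_fun setT W. Proof. exact: measurable_sum. Qed.

Let VX_indep i : independent2 P (xi i) (V i).
Proof. by apply: xi_indep; rewrite eqxx. Qed.

(** Integrating out V_i at fixed xi_i. The xi_i left inside the expectation then acts as the
    independent copy compared with a fixed y. *)
Let pE i : integrableR P (fun w => M i (xi i w) + H i (xi i w) - c) /\
  q = Ex P (fun w => M i (xi i w) + H i (xi i w) - c).
Proof.
pose g (x : R * R) := m (x.2 + x.1) + h (x.2 + x.1) - c.
have gint (u : T -> R) : measurable_fun setT u ->
    integrableR P (fun w => m (u w) + h (u w) - c).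
  move=> mu; apply: integrableRB; last exact: integrableR_cst.
  by apply: integrableRD; [exact: integrable_m|exact: integrable_h].
have mg : measurable_fun setT g.
  have ms : measurable_fun setT (fun x : R * R => x.2 + x.1) by exact: measurable_funD.
  apply: measurable_funB => //; apply: measurable_funD; exact: measurableT_comp.
have gE w : Ex P (fun w' => g (xi i w, V i w')) = M i (xi i w) + H i (xi i w) - c.
  have i1 := integrable_m (mVu i (xi i w)); have i2 := integrable_h (mVu i (xi i w)).
  have ic := integrableR_cst P c.
  by rewrite (ExB (integrableRD i1 i2) ic) (ExD i1 i2) Ex_cst.
have [|w|] := Ex_independent2 (mxi i) (mV i) (VX_indep i) mg.
- exact: (gint (fun w => V i w + xi i w) (measurable_funD (mV i) (mxi i))).
- exact: (gint _ (mVu i (xi i w))).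
rewrite (_ : (fun w => Ex P _) = (fun w => M i (xi i w) + H i (xi i w) - c)); last first.
  by apply/funext => w; rewrite gE.
move=> h1 <-; split; first exact: h1.
congr (Ex P _); apply/funext => w.
by rewrite /g/= -WE.
Qed.

Let fE i : integrableR P (fun w => xi i w * F i (xi i w)) /\
  Ex P (fun w => xi i w * f (W w)) = Ex P (fun w => xi i w * F i (xi i w)).
Proof.
pose g (x : R * R) := x.1 * f (x.2 + x.1).
have ms : measurable_fun setT (fun x : R * R => x.2 + x.1) by exact: measurable_funD.
have mg : measurable_fun setT g.
  by apply: measurable_funM => //; exact: measurableT_comp.
have gE w : Ex P (fun w' => g (xi i w, V i w')) = xi i w * F i (xi i w).
  by rewrite /g/= ExZ//; exact: integrable_f.
have [|w|] := Ex_independent2 (mxi i) (mV i) (VX_indep i) mg.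
- rewrite /g/=; apply: (integrableRM_bounded (c := mills z + mills (- z))) => //.
    by apply: measurableT_comp => //; exact: measurable_funD.
  by move=> w; exact: stein_sol_norm_le.
- by rewrite /g/=; apply/integrableRZ/integrable_f.
rewrite (_ : (fun w => Ex P _) = (fun w => xi i w * F i (xi i w))); last first.
  by apply/funext => w; rewrite gE.
move=> h1 <-; split; first exact: h1.
congr (Ex P _); apply/funext => w.
by rewrite /g/= -WE.
Qed.

Let kappa0 : 0 <= kappa.
Proof. by have /andP[b0 _] := beta_bnd; rewrite /kappa mulr_ge0 ?ltW// divr_ge0. Qed.

(** [increment_dist] averaged over the independent copy x of xi_i, at fixed y. *)
Let increment_q i y : `|y * q - (F i y - F i 0)| <= `|y| * Num.min 1 (e i + kappa + `|y|).
Proof.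
have [pi ->] := pE i.
have e0 : 0 <= e i by apply: Ex_ge0 => w; have /andP[] := Y01 i w.
have Yi : integrableR P (Y i) by have := YX_int 1 i.
have d0 := integrableR_cst P (F i y - F i 0).
rewrite -(ExZ _ pi) -[X in _ - X](Ex_cst P) -(ExB (integrableRZ y pi) d0).
have di := integrableRB (integrableRZ y pi) d0.
apply: (le_trans (Ex_le_norm di)).
have bnd w : `|y * (M i (xi i w) + H i (xi i w) - c) - (F i y - F i 0)| <=
    `|y| * B (`|xi i w| + `|y|).
  exact: (increment_dist (F_incr i) B_incr (M_incr i) (H_incr i)).
have [h1|h1] := leP 1 (e i + kappa + `|y|).
  rewrite -[leRHS](Ex_cst P); apply: Ex_le => [||w].
  - exact: integrableR_norm.
  - exact: integrableR_cst.
  - by apply: (le_trans (bnd w)); rewrite ler_wpM2l// /B ge_min lexx.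
have cy := integrableR_cst P (kappa + `|y|).
have -> : e i + kappa + `|y| = Ex P (fun w => Y i w + (kappa + `|y|)).
  by rewrite (ExD Yi cy) Ex_cst addrA.
rewrite -(ExZ _ (integrableRD Yi cy)).
apply: Ex_le => [||w].
- exact: integrableR_norm.
- exact/integrableRZ/integrableRD.
(* min(1, kappa + |x| + |y|) <= min(1, |x|) + kappa + |y|. Keeping |x| capped makes [e i] the mean
   of [Y i], for which e a <= b2 + b3 is available. *)
apply: (le_trans (bnd w)); rewrite ler_wpM2l// /B /Y.
have := normr_ge0 y; have := kappa0; have := normr_ge0 (xi i w).
by case: (leP 1 (kappa + (`|xi i w| + `|y|))); case: (leP 1 `|xi i w|); lra.
Qed.

(** As E xi_i = 0, the constant F_i(0) can be subtracted for free, leaving E of xi_i times the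
    quantity in [increment_q]. The minimum is bounded by 1 where |xi_i| > 1, giving b2, and by its
    other argument elsewhere. *)
Let stein_dist i : `|Ex P (fun w => xi i w ^+ 2) * q - Ex P (fun w => xi i w * f (W w))| <=
  b2 i + (e i + kappa) * a i + b3 i.
Proof.
have [fi ->] := fE i.
have x2q : integrableR P (fun w => q * xi i w ^+ 2) by exact: integrableRZ.
have xF0 : integrableR P (fun w => F i 0 * xi i w) by exact: integrableRZ.
have -> : Ex P (fun w => xi i w ^+ 2) * q - Ex P (fun w => xi i w * F i (xi i w)) =
    Ex P (fun w => q * xi i w ^+ 2 - (xi i w * F i (xi i w) - F i 0 * xi i w)).
  rewrite (ExB x2q (integrableRB fi xF0)) (ExB fi xF0) (ExZ _ (xi2 i)) (ExZ _ (xii i)).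
  by rewrite xi0 mulr0 subr0 mulrC.
have Di := integrableRB x2q (integrableRB fi xF0).
apply: (le_trans (Ex_le_norm Di)).
have sl := integrable_sqr_large mxi xi2 i.
have ss := integrable_sqr_small mxi xi2 i.
have cs := integrable_cube_small P mxi i.
have ess := integrableRZ (e i + kappa) ss.
rewrite /a -(ExZ _ ss) -(ExD sl ess) -(ExD (integrableRD sl ess) cs).
apply: Ex_le => [||w].
- exact: integrableR_norm.
- exact/integrableRD/cs/integrableRD.
have factor (x r u v : R) : r * x ^+ 2 - (x * u - v * x) = x * (x * r - (u - v)) by ring.
rewrite factor normrM; apply: (le_trans (ler_wpM2l _ (increment_q i (xi i w)))) => //.
rewrite /sqr_large /sqr_small /cube_small -[xi i w ^+ 2]real_normK ?num_real//.
have := normr_ge0 (xi i w); move: `|xi i w| => x x0.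
have mn : Num.min 1 (e i + kappa + x) <= 1 /\ Num.min 1 (e i + kappa + x) <= e i + kappa + x.
  by rewrite !ge_min !lexx orbT.
have [mn1 mn2] := mn; have xx0 : 0 <= x * x by rewrite mulr_ge0.
rewrite [leLHS]mulrA; have [x1|x1] := leP x 1.
  rewrite mulr0 !mulr1 add0r; apply: (le_trans (ler_wpM2l xx0 mn2)).
  by rewrite le_eqVlt; apply/orP; left; apply/eqP; ring.
rewrite !mulr0 mulr1 !addr0; apply: (le_trans (ler_wpM2l xx0 mn1)).
by rewrite mulr1 expr2.
Qed.

(** Since the variances add up to 1, q is distributed over the summands and the Stein identity
    becomes a sum of the differences in [stein_dist]. Each is at most 2 (b2 + b3) + kappa a, and sum
    a <= 1. *)
Lemma berry_esseen : `|Ex P \1_[set w | \sum_k xi k w <= z] - c| <= 41 / 10 * beta.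
Proof.
have im := integrable_m mW; have ih := integrable_h mW.
have ic := integrableR_cst P c.
have xif k : integrableR P (fun w => xi k w * f (W w)).
  apply: (integrableRM_bounded (c := mills z + mills (- z))) => //.
    exact: measurableT_comp.
  by move=> w; exact: stein_sol_norm_le.
have -> : Ex P \1_[set w | \sum_k xi k w <= z] - c =
    \sum_k (Ex P (fun w => xi k w ^+ 2) * q - Ex P (fun w => xi k w * f (W w))).
  rewrite sumrB -mulr_suml xi_var mul1r.
  rewrite -Ex_sum// /q (ExB (integrableRD im ih) ic) (ExD im ih) Ex_cst.
  have -> : Ex P (fun w => m (W w)) = Ex P (fun w => \sum_k xi k w * f (W w)).
    by congr (Ex P _); apply/funext => w; rewrite /m {1}/W mulr_suml.
  have -> : \1_[set w | \sum_k xi k w <= z] = (fun w => h (W w)).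
    by apply/funext => w; rewrite indicE mem_setE.
  by ring.
apply: (le_trans (ler_norm_sum _ _ _)).
apply: (@le_trans _ _ (\sum_k (2 * (b2 k + b3 k) + kappa * a k))).
  apply: ler_sum => k _; apply: (le_trans (stein_dist k)).
  by have := Ex_min_sqr_small k; lra.
rewrite big_split/= -!mulr_sumr big_split/= -/(trunc_beta P xi) -/beta.
have : \sum_k a k <= 1.
  rewrite -xi_var; apply: ler_sum => k _; rewrite (Ex_sqr_split mxi xi2) lerDl.
  by apply: Ex_ge0 => w; rewrite mulr_ge0 ?exprn_ge0.
by move=> /(ler_wpM2l kappa0); rewrite /kappa; lra.
Qed.

End berry_esseen.

(** * Assembly of the three bounds *)

Lemma sup_dist_le (R : realType) (F G : R -> \bar R) (x : \bar R) :
  (forall z, (`|F z - G z| <= x)%E) -> (sup_dist F G <= x)%E.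
Proof. by move=> FGx; apply: ge_ereal_sup => _ [z _ <-]. Qed.

Lemma prob_dist_le1 (R : realType) (x y : \bar R) :
  (0 <= x -> x <= 1 -> 0 <= y -> y <= 1 -> `|x - y| <= 1)%E.
Proof.
move: x y => [x| |] [y| |] //=; rewrite !lee_fin ler_norml => *; lra.
Qed.

Lemma lee_dist_add (R : realType) (t v p b : R) (x : \bar R) : (0 <= x)%E ->
  (`|t%:E - v%:E| <= (2 * b)%:E + x)%E -> `|v - p| <= 41 / 10 * b ->
  (`|t%:E - p%:E| <= (61 / 10 * b)%:E + x)%E.
Proof.
move: x => [x| |] //=; last by move=> *; rewrite leey.
rewrite !lee_fin => _ h1 h2; apply: (le_trans (ler_distD v _ _)); lra.
Qed.

Local Open Scope ereal_scope.

Theorem theorem2p1 (R : realType) (d : measure_display)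
  (Omega : measurableType d) (P : probability Omega R) (n : nat)
  (X : 'I_n -> {RV P >-> R}) (stat : n.-tuple R -> R)
  (g : 'I_n -> R -> R) (Delta_ : 'I_n -> {RV P >-> R}) :
  let xi : 'I_n -> Omega -> R := fun i w => g i (X i w) in
  let T : Omega -> R := fun w => stat [tuple X i w | i < n] in
  let W : Omega -> R := fun w => (\sum_(i < n) xi i w)%R in
  let Delta : Omega -> R := fun w => (T w - W w)%R in
  let cdfT : R -> \bar R := fun z => P [set w | (T w <= z)%R] in
  let cdfW : R -> \bar R := fun z => P [set w | (W w <= z)%R] in
  let rem : \bar R :=
    'E_P[(fun w => `|W w * Delta w|%R)]
    + \sum_(i < n) 'E_P[(fun w => `|xi i w * (Delta w - Delta_ i w)|%R)] in
  let beta : \bar R :=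
    \sum_(i < n)
      'E_P[(fun w => (`|xi i w| ^+ 2 * (1 < `|xi i w|)%R%:R)%R)]
    + \sum_(i < n)
      'E_P[(fun w => (`|xi i w| ^+ 3 * (`|xi i w| <= 1)%R%:R)%R)] in
  mutually_independent X ->
  measurable_fun [set: n.-tuple R] stat ->
  (forall i, measurable_fun [set: R] (g i)) ->
  (forall i, 'E_P[xi i] = 0) ->
  \sum_(i < n) 'E_P[(fun w => (xi i w ^+ 2)%R)] = 1 ->
  (forall i, independent2 P (X i) (fun w => (Delta_ i w, (W w - xi i w)%R))) ->
  [/\ forall delta : R, (0 < delta)%R ->
        (2^-1)%:E <=
          \sum_(i < n) 'E_P[(fun w =>
            (`|xi i w| * Num.min delta `|xi i w|)%R)] ->
        sup_dist cdfT cdfW <= (4 * delta)%:E + rem,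
      sup_dist cdfT cdfW <= 2%:E * beta + rem &
      sup_dist cdfT (@Phi R) <= (61 / 10)%:E * beta + rem].
Proof.
move=> xi T W Delta cdfT cdfW rem beta mX mstat mg E0 V1 Dind.
have mxi i : measurable_fun setT (xi i) by exact: measurableT_comp.
have mW : measurable_fun setT W by exact: measurable_sum.
have mT : measurable_fun setT T.
  apply: measurableT_comp => //; apply/measurable_fun_tnthP => i.
  by rewrite (_ : _ \o _ = X i)//; apply/funext => w /=; rewrite tnth_mktuple.
have EE (f : Omega -> R) : 'E_P[f] = \int[P]_w (f w)%:E by rewrite unlock.
(* Finiteness comes from the normalization: nonnegative extended expectations with sum 1 are each at
   most 1. *)
have xi2 i : integrableR P (fun w => (xi i w ^+ 2)%R).
  apply/integrableP; split; first exact/measurable_EFinP/measurable_funX.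
  under eq_integral do rewrite gee0_abs ?lee_fin ?sqr_ge0//.
  apply: (@le_lt_trans _ _ 1); last exact: ltry.
  rewrite -V1 (bigD1 i)//= EE leeDl// sume_ge0// => j _.
  by rewrite EE; apply: integral_ge0 => w _; rewrite lee_fin sqr_ge0.
have xii i : integrableR P (xi i) by exact: integrableR_sqr.
have xi0 i : Ex P (xi i) = 0%R.
  by apply: EFin_inj; rewrite -Ex_EFin// -EE E0.
have var1 : (\sum_i Ex P (fun w => xi i w ^+ 2) = 1)%R.
  apply: EFin_inj; rewrite -sumEFin -V1; apply: eq_bigr => i _.
  by rewrite EE Ex_EFin.
have xi_indep i (Q : pred 'I_n) : ~~ Q i ->
    independent2 P (xi i) (fun w => \sum_(k | Q k) xi k w)%R.
  move=> Qi; have := mutually_independent_indep2 mX mg Qi.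
  exact: (independent2_comp (mg i) (@measurable_id _ _ setT)).
have pair_indep := pairwise_independent xi_indep.
have var_le1 : (\sum_i Ex P (fun w => xi i w ^+ 2) <= 1)%R by rewrite var1.
have D_indep i : independent2 P (xi i) (fun w => (Delta_ i w, W w - xi i w)%R).
  exact: (independent2_comp (mg i) (@measurable_id _ _ setT) (Dind i)).
have mD_ i : measurable_fun setT (Delta_ i) by [].
have remE : rem = \int[P]_w (`|W w * Delta w|%R)%:E +
    \sum_i \int[P]_w (`|xi i w * (Delta w - Delta_ i w)|%R)%:E.
  by rewrite /rem EE; congr (_ + _); apply: eq_bigr => i _; rewrite EE.
have rem0 : 0 <= rem.
  rewrite remE adde_ge0 ?integral_ge0// ?sume_ge0// => *.
  by rewrite integral_ge0// => *; rewrite lee_fin.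
pose b := trunc_beta P xi.
have betaE : beta = b%:E.
  rewrite /beta /b /trunc_beta EFinD -!sumEFin; congr (_ + _); apply: eq_bigr => i _.
    by rewrite EE Ex_EFin//; exact: integrable_sqr_large.
  by rewrite EE Ex_EFin//; exact: integrable_cube_small.
have b0 : (0 < b)%R by exact: trunc_beta_gt0.
have mcdf (Y : Omega -> R) z : measurable_fun setT Y -> measurable [set w | (Y w <= z)%R].
  by move=> mY; exact: measurable_le_set.
have cdf_dist delta : (0 < delta)%R ->
    (2^-1 <= \sum_i Ex P (fun w => `|xi i w| * Num.min delta `|xi i w|))%R ->
    forall z, `|cdfT z - cdfW z| <= (3 * delta)%:E + rem.
  move=> d0 s_ge z; rewrite remE.
  exact: (cdf_dist_le mxi xi2 xi0 pair_indep var_le1 d0 mT mD_ D_indep s_ge).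
have cdf_dist_beta z : `|cdfT z - cdfW z| <= (2 * b)%:E + rem.
  have [b12|b12] := ltP b 2^-1%R; last first.
    apply: (@le_trans _ _ 1).
      by apply: prob_dist_le1 => //; apply: probability_le1; exact: mcdf.
    by rewrite -[1]adde0 leeD// lee_fin; lra.
  apply: le_trans (cdf_dist (b / 2)%R _ _ z) _.
  - by rewrite divr_gt0.
  - by apply: sum_Ex_eta_half => //; rewrite b0.
  - by rewrite leeD2r// lee_fin; lra.
split=> [delta d0 s_ge||].
- apply: sup_dist_le => z; apply: le_trans (cdf_dist delta d0 _ z) _.
    rewrite -lee_fin (le_trans s_ge)// -sumEFin lee_sum// => i _.
    by rewrite EE Ex_EFin//; exact: integrable_eta.
  by rewrite leeD2r// lee_fin; lra.
- by apply: sup_dist_le => z; rewrite betaE -EFinM.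
- apply: sup_dist_le => z; rewrite betaE -EFinM.
  have [b1|b1] := leP b (10 / 41)%R; last first.
    apply: (@le_trans _ _ 1).
      apply: prob_dist_le1 => //; apply: probability_le1 => //; exact: mcdf.
    by rewrite -[1]adde0 leeD// lee_fin; lra.
  have fT : cdfT z = (fine (cdfT z))%:E.
    by rewrite fineK// fin_num_measure//; exact: mcdf.
  have fW : cdfW z = (Ex P \1_[set w | (W w <= z)%R])%:E.
    by rewrite Ex_indic//; exact: mcdf.
  have := cdf_dist_beta z; rewrite fT fW ncdf_EFin => h.
  apply: lee_dist_add rem0 h _.
  by apply: berry_esseen => //; rewrite b0.
Qed.
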